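(* Let $K$ be a nontrivial snark with $\mathrm{df}(K)\ge 4$, let $v$ be a vertex of $K$, and let $G$ be the snark created from $K$ by inflating $v$ to a triangle. Then $\mathrm{df}(G)=3$ if and only if $v$ lies in a heavy cluster of $5$-cycles of $K$.
   Context: Graphs are finite; loops and multiple edges are allowed. A cubic graph is colourable if it admits a proper $3$-edge-colouring. A snark is a $2$-connected cubic graph that is not colourable. A snark is nontrivial if it is cyclically $4$-edge-connected (the removal of fewer than $4$ edges never leaves at least two components containing circuits) and has girth at least $5$. A $3$-array of a cubic graph $G$ is a collection $\{M_1,M_2,M_3\}$ of three not necessarily distinct perfect matchings of $G$. An edge is uncovered if it belongs to none of $M_1,M_2,M_3$. The (colouring) defect $\mathrm{df}(G)$ is the minimum number of uncovered edges over all $3$-arrays of $G$. Inflating a vertex $v$ of a cubic graph to a triangle means replacing $v$ by a triangle, attaching the three edges formerly incident with $v$ to the three distinct vertices of the triangle. A cluster of $5$-cycles ($5$-cluster) of a cubic graph is an inclusion-wise maximal connected subgraph formed by a union of $5$-cycles. For an edge $e$ of a cubic graph $G$, $G\sim e$ denotes the cubic graph obtained from $G$ by deleting $e$ and suppressing the two resulting $2$-valent vertices. A $5$-cluster $H$ of a snark $G$ is heavy if $G\sim e$ is $3$-edge-colourable for each edge $e$ of $H$. (If $e=uv$ is an edge of a snark $G$, then $G\sim e$ is $3$-edge-colourable if and only if $G-\{u,v\}$ is.) *)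

(* Defs.v *)
From mathcomp Require Import all_boot.

Set Implicit Arguments.
Unset Strict Implicit.
Unset Printing Implicit Defensive.

(* Finite graphs with loops and multiple edges, given by half-edges (darts).
   The dart d starts at the vertex [base d], and [opp d] is the other half of
   the same edge.  A loop is an edge whose two darts have the same base. *)
Record mgraph := MGraph {
  vert : finType;
  dart : finType;
  base : dart -> vert;
  opp : dart -> dart;
  oppK : involutive opp;
  opp_neq : forall d, opp d != d
}.

Section Basics.
Variable G : mgraph.
Implicit Types (x y : vert G) (d : dart G) (c : seq (dart G)).

Definition edge_of d : {set dart G} := [set d; opp d].
Definition edges : {set {set dart G}} := [set edge_of d | d : dart G].

Lemma edge_of_opp d : edge_of (opp d) = edge_of d.
Proof. by rewrite /edge_of oppK setUC. Qed.

(* A loop contributes 2. *)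
Definition degree x : nat := #|[set d | base d == x]|.

Definition cubic : Prop := forall x, degree x = 3.

(* No graph with a loop is colourable: the two darts of a loop have the same
   base and the same colour. *)
Definition colourable : Prop :=
  exists col : {set dart G} -> 'I_3,
    forall d d', base d = base d' -> d != d' ->
      col (edge_of d) != col (edge_of d').

Definition adj : rel (vert G) :=
  [rel x y | [exists d, (base d == x) && (base (opp d) == y)]].

Definition connected : Prop := forall x y, connect adj x y.

Definition components : {set {set vert G}} :=
  [set [set y | connect adj x y] | x : vert G].

(* Circuits as cyclic sequences of darts.  The last condition only matters for
   two darts, where it rules out going back and forth along one edge. *)
Definition circuit c : bool :=
  [&& c != [::],
      cycle (fun d d' => base (opp d) == base d') c,
      uniq [seq base d | d <- c]
    & uniq [seq edge_of d | d <- c]].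

Definition girth_at_least (n : nat) : Prop :=
  forall c, circuit c -> n <= size c.

Definition contains_circuit (C : {set vert G}) : Prop :=
  exists2 c, circuit c & {in c, forall d, base d \in C}.

End Basics.

Section DeleteEdges.
Variables (G : mgraph) (S : {set {set dart G}}).

Definition del_edges_dart : finType := {d : dart G | edge_of d \notin S}.

Fact del_edges_subproof (d : del_edges_dart) : edge_of (opp (val d)) \notin S.
Proof. by rewrite edge_of_opp (valP d). Qed.

Definition del_edges_opp (d : del_edges_dart) : del_edges_dart :=
  Sub (opp (val d)) (del_edges_subproof d).

Fact del_edges_oppK : involutive del_edges_opp.
Proof. by move=> d; apply/val_inj; rewrite /= oppK. Qed.

Fact del_edges_opp_neq d : del_edges_opp d != d.
Proof. by rewrite -val_eqE /= opp_neq. Qed.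

Definition del_edges : mgraph :=
  @MGraph (vert G) del_edges_dart (fun d => base (val d))
          del_edges_opp del_edges_oppK del_edges_opp_neq.

End DeleteEdges.

Section DeleteVertex.
Variables (G : mgraph) (x : vert G).

Definition del_vert_vert : finType := {y : vert G | y != x}.
Definition del_vert_dart : finType :=
  {d : dart G | (base d != x) && (base (opp d) != x)}.

Fact del_vert_base_subproof (d : del_vert_dart) : base (val d) != x.
Proof. by case/andP: (valP d). Qed.

Definition del_vert_base (d : del_vert_dart) : del_vert_vert :=
  Sub (base (val d)) (del_vert_base_subproof d).

Fact del_vert_opp_subproof (d : del_vert_dart) :
  (base (opp (val d)) != x) && (base (opp (opp (val d))) != x).
Proof. by rewrite oppK andbC (valP d). Qed.

Definition del_vert_opp (d : del_vert_dart) : del_vert_dart :=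
  Sub (opp (val d)) (del_vert_opp_subproof d).

Fact del_vert_oppK : involutive del_vert_opp.
Proof. by move=> d; apply/val_inj; rewrite /= oppK. Qed.

Fact del_vert_opp_neq d : del_vert_opp d != d.
Proof. by rewrite -val_eqE /= opp_neq. Qed.

Definition del_vert : mgraph :=
  @MGraph del_vert_vert del_vert_dart del_vert_base
          del_vert_opp del_vert_oppK del_vert_opp_neq.

End DeleteVertex.

(* Suppression of all the 2-valent vertices of G.  The remaining darts are those
   based at a vertex of degree other than 2; the opposite of such a dart d is
   found by leaving along d, walking straight through 2-valent vertices, and
   taking the dart by which the walk arrives at the first vertex of another
   degree.  (Components that are circuits of 2-valent vertices disappear.) *)
Section Suppress.
Variable G : mgraph.
Implicit Types d : dart G.

Definition kept d : bool := degree (base d) != 2.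

(* The other dart at a 2-valent vertex. *)
Definition turn d : dart G :=
  if kept d then d
  else odflt d [pick d' | (base d' == base d) && (d' != d)].

Definition suppress_step d : dart G := opp (turn d).

Definition suppress_next d : dart G :=
  head d [seq d' <- orbit suppress_step (suppress_step d) | kept d'].

Lemma base_turn d : base (turn d) = base d.
Proof. by rewrite /turn; case: ifP => // _; case: pickP => //= d' /andP[/eqP]. Qed.

Lemma kept_turn d : kept (turn d) = kept d.
Proof. by rewrite /kept base_turn. Qed.

Lemma turn_kept d : kept d -> turn d = d.
Proof. by rewrite /turn => ->. Qed.

Lemma turn_neq d : ~~ kept d -> turn d != d.
Proof.
move=> Nk; rewrite /turn (negPf Nk); case: pickP => /= [d' /andP[]//|none].
move: Nk; rewrite negbK => /eqP; rewrite /degree.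
rewrite (_ : [set _ | _] = [set d]) ?cards1 //.
apply/setP=> d'; rewrite !inE; have := none d'.
by case: (d' =P d) => [->|_]; rewrite ?eqxx ?andbT.
Qed.

Lemma turnK : involutive turn.
Proof.
move=> d; have [k|Nk] := boolP (kept d); first by rewrite !turn_kept.
have n1 := turn_neq Nk; have n2 : turn (turn d) != turn d.
  by apply: turn_neq; rewrite kept_turn.
apply/eqP; apply: contraNT Nk => n3; rewrite /kept neq_ltn; apply/orP; right.
rewrite /degree; apply: (@leq_trans #|turn (turn d) |: [set d; turn d]|).
  by rewrite cardsU1 !inE negb_or n2 n3 cards2 eq_sym n1.
apply/subset_leq_card/subsetP=> d'.
by rewrite !inE => /or3P[] /eqP->; rewrite ?base_turn.
Qed.

Lemma suppress_step_inj : injective suppress_step.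
Proof. exact: inj_comp (can_inj (@oppK G)) (can_inj turnK). Qed.

Lemma suppress_nextP d : kept d ->
  exists n, [/\ suppress_next d = iter n.+1 suppress_step d,
                kept (iter n.+1 suppress_step d)
              & forall k, k < n -> ~~ kept (iter k.+1 suppress_step d)].
Proof.
set g := suppress_step => kd; set s := orbit g (g d).
have sd : d \in s.
  rewrite -fconnect_orbit fconnect_sym; last exact: suppress_step_inj.
  exact: fconnect1.
have hs : has kept s by apply/hasP; exists d.
have head_filter (t : seq (dart G)) :
    has kept t -> head d (filter kept t) = nth d t (find kept t).
  by elim: t => //= a t IH; case: ifP.
have nthE k : k < size s -> nth d s k = iter k.+1 g d.
  by move=> lt; rewrite (set_nth_default (g d)) // iterSr nth_traject -?size_orbit.
have lts : find kept s < size s by rewrite -has_find.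
have E : suppress_next d = nth d s (find kept s) by exact: head_filter.
exists (find kept s); split; first by rewrite E nthE.
  by rewrite -nthE ?nth_find.
move=> k ltk; rewrite -nthE ?(ltn_trans ltk) //.
by rewrite before_find.
Qed.

Lemma suppress_nextE d n : kept (iter n.+1 suppress_step d) ->
    (forall k, k < n -> ~~ kept (iter k.+1 suppress_step d)) -> kept d ->
  suppress_next d = iter n.+1 suppress_step d.
Proof.
move=> kn Nk kd; have [m [-> km Nm]] := suppress_nextP kd.
by case: (ltngtP m n) => [/Nk|/Nm|->//]; rewrite ?kn ?km.
Qed.

Lemma iter_turn n d d' :
  iter n suppress_step d = d' -> iter n suppress_step (turn d') = turn d.
Proof.
elim: n d d' => [|n IH] d d' /=; first by move->.
move=> <-; rewrite -iterS iterSr {2}/suppress_step turnK /suppress_step oppK.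
exact: IH.
Qed.

Lemma kept_suppress_next d : kept d -> kept (suppress_next d).
Proof. by move=> /suppress_nextP[n [->]]. Qed.

Lemma suppress_nextK d : kept d -> suppress_next (suppress_next d) = d.
Proof.
move=> kd; have [n [-> kr Nk]] := suppress_nextP kd.
have rev := iter_turn (erefl (iter n.+1 suppress_step d)).
rewrite !turn_kept // in rev.
rewrite (@suppress_nextE _ n) ?rev // => k ltkn.
have E : iter k.+1 suppress_step (iter (n - k) suppress_step d)
       = iter n.+1 suppress_step d.
  by rewrite -iterD addSn subnKC // ltnW.
move/iter_turn: E; rewrite (turn_kept kr) => ->.
rewrite kept_turn -subnSK //; apply: Nk.
by rewrite subnS prednK ?subn_gt0 // leq_subr.
Qed.

Lemma suppress_next_neq d : kept d -> suppress_next d != d.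
Proof.
move=> kd; have [n [-> _ Nk]] := suppress_nextP kd; apply/eqP => fixd.
have mid m k : m + k = n.+1 ->
    iter m suppress_step d = turn (iter k suppress_step d).
  move=> mk; rewrite -{1}(turn_kept kd); apply: iter_turn.
  by rewrite -iterD mk.
have [odd_n|even_n] := boolP (odd n).
- have E : n = (n./2).*2.+1 by rewrite -[LHS]odd_double_half odd_n.
  have sum : n./2.+1 + n./2.+1 = n.+1 by rewrite addSn addnS addnn -E.
  have /eqP := esym (mid _ _ sum); rewrite (negPf (turn_neq _)) //.
  by apply: Nk; rewrite {2}E ltnS -addnn leq_addr.
- have E : n = (n./2).*2 by rewrite -[LHS]odd_double_half (negPf even_n).
  have := mid n./2.+1 n./2; rewrite addSn addnn -E => /(_ erefl) /= /eqP.
  by rewrite {1}/suppress_step (negPf (opp_neq _)).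
Qed.

Definition suppress_vert : finType := {x : vert G | degree x != 2}.
Definition suppress_dart : finType := {d : dart G | kept d}.

Definition suppress_base (d : suppress_dart) : suppress_vert :=
  Sub (base (val d)) (valP d).

Definition suppress_opp (d : suppress_dart) : suppress_dart :=
  Sub (suppress_next (val d)) (kept_suppress_next (valP d)).

Fact suppress_oppK : involutive suppress_opp.
Proof. by move=> d; apply/val_inj; rewrite /= suppress_nextK ?(valP d). Qed.

Fact suppress_opp_neq (d : suppress_dart) : suppress_opp d != d.
Proof. by rewrite -val_eqE /= suppress_next_neq ?(valP d). Qed.

Definition suppress : mgraph :=
  @MGraph suppress_vert suppress_dart suppress_base
          suppress_opp suppress_oppK suppress_opp_neq.

End Suppress.

(* [G ~ e] where e is the edge of the dart d; when G is cubic and e is not a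
   loop, the 2-valent vertices of [G - e] are exactly the two ends of e. *)
Definition del_suppress (G : mgraph) (d : dart G) : mgraph :=
  suppress (del_edges [set edge_of d]).

(* Inflation of v to a triangle.  The vertices of the triangle are the darts at
   v, and its darts are the pairs of distinct darts at v: the dart (p, q) goes
   from p to q.  Each old dart p at v is now based at the triangle vertex p.
   (For deg v = 3 this is a triangle; in general it is a complete graph.) *)
Section Inflate.
Variables (G : mgraph) (v : vert G).

Definition darts_at : finType := {d : dart G | base d == v}.
Definition inflate_vert : finType := ({x : vert G | x != v} + darts_at)%type.
Definition inflate_dart : finType :=
  (dart G + {p : darts_at * darts_at | p.1 != p.2})%type.

Definition inflate_base (d : inflate_dart) : inflate_vert :=
  match d with
  | inl d0 =>
      match boolP (base d0 == v) with
      | AltTrue at_v => inr (Sub d0 at_v)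
      | AltFalse off_v => inl (Sub (base d0) off_v)
      end
  | inr p => inr (val p).1
  end.

Fact inflate_opp_subproof (p : {p : darts_at * darts_at | p.1 != p.2}) :
  ((val p).2, (val p).1).1 != ((val p).2, (val p).1).2.
Proof. by rewrite eq_sym (valP p). Qed.

Definition inflate_opp (d : inflate_dart) : inflate_dart :=
  match d with
  | inl d0 => inl (opp d0)
  | inr p => inr (Sub ((val p).2, (val p).1) (inflate_opp_subproof p))
  end.

Fact inflate_oppK : involutive inflate_opp.
Proof.
case=> [d|p] /=; first by rewrite oppK.
by congr inr; apply/val_inj => /=; case: (val p).
Qed.

Fact inflate_opp_neq d : inflate_opp d != d.
Proof.
case: d => [d|[[a b] ab]]; first exact: (opp_neq d).
by apply/eqP => -[/= E _]; rewrite /= E eqxx in ab.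
Qed.

Definition inflate : mgraph :=
  @MGraph inflate_vert inflate_dart inflate_base
          inflate_opp inflate_oppK inflate_opp_neq.

End Inflate.

(* Requiring more than two vertices is the usual convention for
   2-connectedness.  It excludes the two-vertex cubic graph with a bridge and
   two loops; the two-vertex cubic graph with a triple edge is colourable. *)
Definition two_connected (G : mgraph) : Prop :=
  [/\ 2 < #|vert G|, connected G & forall x : vert G, connected (del_vert x)].

Definition snark (G : mgraph) : Prop :=
  [/\ cubic G, two_connected G & ~ colourable G].

Definition cyclically_edge_connected (k : nat) (G : mgraph) : Prop :=
  forall S : {set {set dart G}}, S \subset edges G -> #|S| < k ->
  forall C1 C2 : {set vert (del_edges S)},
    C1 \in components (del_edges S) -> contains_circuit C1 ->
    C2 \in components (del_edges S) -> contains_circuit C2 ->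
    C1 = C2.

Definition nontrivial_snark (G : mgraph) : Prop :=
  [/\ snark G, cyclically_edge_connected 4 G & girth_at_least G 5].

Section Defect.
Variable G : mgraph.
Implicit Types M : {set {set dart G}}.

Definition perfect_matching M : bool :=
  (M \subset edges G) &&
  [forall x : vert G, #|[set d | (base d == x) && (edge_of d \in M)]| == 1].

Definition array3 : finType := {ffun 'I_3 -> {set {set dart G}}}.

Definition is_array3 (A : array3) : bool := [forall i, perfect_matching (A i)].

Definition uncovered (A : array3) : {set {set dart G}} :=
  edges G :\: \bigcup_(i < 3) A i.

(* The default value [#|edges G|] bounds the number of uncovered edges from
   above, so this is the minimum as soon as G has a perfect matching, as every
   2-connected cubic graph does. *)
Definition defect : nat :=
  \big[minn/#|edges G|]_(A : array3 | is_array3 A) #|uncovered A|.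

End Defect.

(* A subgraph that is a union of cycles is represented by its set of edges. *)
Section Clusters.
Variable G : mgraph.
Implicit Types H : {set {set dart G}}.

Definition five_cycles : {set {set {set dart G}}} :=
  [set [set edge_of d | d in (c : 5.-tuple (dart G))]
     | c : 5.-tuple (dart G) & circuit c].

Definition vertices_of H : {set vert G} :=
  [set base d | d : dart G & edge_of d \in H].

Definition adj_in H : rel (vert G) :=
  [rel x y | [exists d, [&& edge_of d \in H, base d == x & base (opp d) == y]]].

Definition connected_in H : bool :=
  [forall x in vertices_of H, forall y in vertices_of H, connect (adj_in H) x y].

Definition union_of_five_cycles H : bool :=
  [exists F : {set {set {set dart G}}},
     [&& F != set0, F \subset five_cycles & H == cover F]].

Definition five_cluster H : bool :=
  maxset (fun A => union_of_five_cycles A && connected_in A) H.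

Definition heavy_cluster H : Prop :=
  five_cluster H /\
  forall d : dart G, edge_of d \in H -> colourable (del_suppress d).

End Clusters.

(* Main.v *)
Require Import Defs.
From mathcomp Require Import all_boot zify.

(* Write G for the inflation of v.  In a 3-array of G with at most three
   uncovered edges, some matching must contain all three edges leaving the
   triangle, since otherwise contracting the triangle gives a 3-array of K with
   at most three uncovered edges.  Counting uncovered edges around the triangle
   then shows that the edges not covered exactly once form a hexagon of G using
   one edge of the triangle.  It contracts to a 5-circuit C of K through v, and
   the array induces a proper 3-edge-colouring of K away from C.

   Given such a colouring for a 5-circuit C, the outer edges of C have colours
   a, b, a, a, c in cyclic order (by parity, and since K is not colourable); the
   vertex between the edges coloured b and c is its centre.  A suitable Kempe
   switch must again give a non-extendable colouring, which forces the centre to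
   move three steps along C; hence every vertex of C can be made the centre.  With
   centre v one can write down a 3-array of G with three uncovered edges, and
   deleting the edge of C opposite to the centre leaves a colourable graph.
   So all edges of C are removable as soon as one is, and as 5-circuits meeting at
   a vertex of a cubic graph share an edge, this spreads over the whole cluster. *)

Set Implicit Arguments.
Unset Strict Implicit.
Unset Printing Implicit Defensive.

(* The two involutions generate a dihedral group; since [s] has no fixed point,
   the orbit of [s \o t] through x has even length N, and its t-fixed points are
   its elements of index 0 and N/2. *)
Lemma dihedral_orbit (T : finType) (s t : T -> T) (x : T) :
    involutive s -> involutive t -> (forall y, s y != y) -> t x = x ->
  exists (X : {set T}) (y : T),
    [/\ x \in X, y \in X, y != x, t y = y &
        [/\ forall z, z \in X -> s z \in X, forall z, z \in X -> t z \in X,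
            forall z, z \in X -> t z = z -> z = x \/ z = y
          & forall A : {set T}, x \in A -> (forall z, z \in A -> s z \in A) ->
              (forall z, z \in A -> t z \in A) -> X \subset A]].
Proof.
move=> sK tK sN tx; pose g := s \o t.
have gI : injective g by apply: inj_comp; apply: can_inj; [apply: sK | apply: tK].
pose N := order g x.
have N0 : 0 < N by exact: order_gt0.
have gN : iter N g x = x by exact: iter_order.
(* As [t] fixes x and conjugates [g] into its inverse, it reverses the index on the orbit. *)
have tg k : k <= N -> t (iter k g x) = iter (N - k) g x.
  have iterI : injective (iter k g) by elim: k => //= k IH; apply: inj_comp.
  move=> kN; apply: iterI; rewrite -iterD subnKC // gN.
  elim: k {kN} => //= k IH; rewrite -iterS iterSr -[RHS]IH; congr (iter k g _).
  by rewrite /g /= tK sK.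
have sg y : s y = g (t y) by rewrite /g /= tK.
have inX y : fconnect g x y -> exists2 k, k < N & y = iter k g x.
  by move=> xy; exists (findex g x y); rewrite ?findex_max ?iter_findex.
have iterX k : fconnect g x (iter k g x) by exact: fconnect_iter.
(* For odd N the element of index [N./2.+1] would be a fixed point of [s]. *)
have Neven : N = N./2 + N./2.
  have [No|/negPf Ne] := boolP (odd N); last by rewrite addnn -[LHS]odd_double_half Ne.
  have := sN (iter N./2.+1 g x); rewrite sg tg; last by lia.
  have -> : N - N./2.+1 = N./2 by lia.
  by rewrite eqxx.
have tX z : fconnect g x z -> fconnect g x (t z).
  by case/inX=> k lk ->; rewrite tg ?iterX // ltnW.
exists [set y | fconnect g x y], (iter N./2 g x); split.
- by rewrite inE connect0.
- by rewrite inE.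
- apply/eqP => E; have := @findex_iter _ g x N./2; rewrite E findex0 -/N; lia.
- by rewrite tg; [congr (iter _ g x); lia | lia].
split.
- move=> z; rewrite !inE => /tX xz; rewrite sg.
  exact: connect_trans xz (fconnect1 _ _).
- by move=> z; rewrite !inE => /tX.
- move=> z; rewrite inE => /inX[k lk ->]; rewrite tg ?(ltnW lk) // => E.
  case: k lk E => [|k] lk E; [by left | right].
  have := @findex_iter _ g x (N - k.+1); have := @findex_iter _ g x k.+1.
  rewrite E -/N lk => -> // /(_ _) e; congr (iter _ g x); have := e _; lia.
move=> A xA sA tA; apply/subsetP => z; rewrite inE => /inX[k _ ->].
by elim: k => //= k IH; apply/sA/tA.
Qed.

Lemma even_card_involution (T : finType) (s : T -> T) (A : {set T}) :
  involutive s -> (forall x, x \in A -> s x \in A) ->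
  (forall x, x \in A -> s x != x) -> ~~ odd #|A|.
Proof.
move=> sK; have [n] := ubnP #|A|; elim: n A => // n IH A leAn sA sN.
have [-> | [x xA]] := set_0Vmem A; first by rewrite cards0.
have sxA : s x \in A :\ x by rewrite in_setD1 sN // sA.
move: leAn; rewrite (cardsD1 x) xA (cardsD1 (s x)) sxA /= negbK => leAn.
apply: IH => [|y|y]; first by lia.
  rewrite !inE => /and3P[yNsx yNx yA]; rewrite sA // (inj_eq (can_inj sK)) yNx /=.
  by rewrite andbT; apply: contra yNsx => /eqP <-; rewrite sK.
by rewrite !inE => /and3P[_ _ /sN].
Qed.

(* The three colours are the elements of [option bool].  [swap z] exchanges the
   two colours other than z. *)
Definition swap (z x : option bool) : option bool :=
  match z, x with
  | None, Some b => Some (~~ b)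
  | Some b, None => Some (~~ b)
  | Some b, Some b' => if b == b' then x else None
  | None, None => None
  end.

Lemma swapK z : involutive (swap z).
Proof. by case: z => [[]|] [[]|]. Qed.

Lemma swap_neq z x : x != z -> swap z x != x.
Proof. by case: z x => [[]|] [[]|]. Qed.

Lemma swap_eq z x : (swap z x == z) = (x == z).
Proof. by case: z x => [[]|] [[]|]. Qed.

Lemma swap_uniq z k l : k != z -> l != z -> k != l -> l = swap z k.
Proof. by case: z k l => [[]|] [[]|] [[]|]. Qed.

(** * Colourings as functions on darts, the parity lemma and Kempe switches *)

Section DartColourings.
Variable G : mgraph.
Implicit Types (c : dart G -> option bool) (x : vert G) (d e : dart G).

Definition opp_invariant (T : Type) (f : dart G -> T) := forall d, f (opp d) = f d.

Definition proper_at c x :=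
  forall d e, base d = x -> base e = x -> c d = c e -> d = e.

(** Nothing is required at [S]: in effect a proper colouring of what remains when [S] is removed,
    dangling edges included. *)
Definition proper_off (S : {pred vert G}) c :=
  opp_invariant c /\ forall x, x \notin S -> proper_at c x.

Lemma mem_edge_of d e : (e \in edge_of d) = (e == d) || (e == opp d).
Proof. by rewrite !inE. Qed.

Lemma edge_ofP d e : reflect (e = d \/ e = opp d) (edge_of e == edge_of d).
Proof.
apply: (iffP eqP) => [/setP/(_ e)|[]->//]; last exact: edge_of_opp.
by rewrite !mem_edge_of eqxx => /esym/orP[]/eqP; [left | right].
Qed.

(** Carries a function from darts to edges; [x0] is only returned on the empty set. *)
Definition colour_of_edge (T : Type) (x0 : T) (f : dart G -> T) (E : {set dart G}) : T :=
  if [pick d in E] is Some d then f d else x0.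

Lemma colour_of_edgeE (T : Type) (x0 : T) (f : dart G -> T) d :
  (forall e, f (opp e) = f e) -> colour_of_edge x0 f (edge_of d) = f d.
Proof.
move=> fo; rewrite /colour_of_edge; case: pickP => [e|/(_ d)].
  by rewrite mem_edge_of => /orP[]/eqP->.
by rewrite mem_edge_of eqxx.
Qed.

Lemma colourableP : colourable G <-> exists c, proper_off pred0 c.
Proof.
split=> [[col colP] | [c [co cP]]].
  pose o2c (i : 'I_3) := if val i is i'.+1 then Some (i' == 0) else None.
  have o2cI : injective o2c.
    by move=> [[|[|[]]] // ?] [[|[|[]]] // ?] // _; apply: val_inj.
  exists (o2c \o col \o (@edge_of G)); split=> [d|x _ d e dx ex] /=.
    by rewrite edge_of_opp.
  move/o2cI=> E; apply/eqP; apply: contraT => /colP.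
  by rewrite dx ex E eqxx => /(_ erefl).
pose c2o (k : option bool) : 'I_3 := inord (if k is Some b then b.+1 else 0).
have c2oI : injective c2o.
  by move=> [[]|] [[]|] // /(congr1 val); rewrite /= !inordK.
exists (colour_of_edge ord0 (c2o \o c)) => d e de; apply: contra => /eqP.
have h f : (c2o \o c) (opp f) = (c2o \o c) f by rewrite /= co.
rewrite !colour_of_edgeE //= => /c2oI E.
by apply/eqP; apply: (cP (base d)).
Qed.

Section Kempe.
Hypothesis cubG : cubic G.
Variables (S : {pred vert G}) (c : dart G -> option bool).
Hypothesis cS : proper_off S c.

Lemma proper_surj x k : x \notin S -> exists2 d, base d = x & c d = k.
Proof.
move=> /(proj2 cS) cI.
have /setP/(_ k) : c @: [set d | base d == x] = [set: option bool].
  apply/eqP; rewrite eqEcard subsetT cardsT card_option card_bool.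
  rewrite card_in_imset => [|d e]; first by rewrite -[#|_|]/(degree x) cubG.
  by rewrite !inE => /eqP dx /eqP ex; apply: cI.
by rewrite !inE => /imsetP[d]; rewrite inE => /eqP dx ->; exists d.
Qed.

(** The darts that take part. In the application [L] leaves out the edges of the 5-circuit, so that
    the boundary darts, those of [L] based in [S], are exactly the outer ones. *)
Variables (L : {pred dart G}).
Hypothesis L_opp : forall d, d \in L -> opp d \in L.
Hypothesis L_off : forall d, base d \notin S -> d \in L.

(* The Kempe chain step at a vertex where c is proper; boundary darts are fixed. *)
Let mate z d :=
  if base d \in S then d else
  odflt d [pick e | (base e == base d) && (c e == swap z (c d))].

Let mate_in z d : base d \in S -> mate z d = d.
Proof. by rewrite /mate => ->. Qed.

Let mateP z d : base d \notin S -> base (mate z d) = base d /\ c (mate z d) = swap z (c d).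
Proof.
move=> dS; rewrite /mate (negPf dS); case: pickP => [e /andP[/eqP-> /eqP->]//|].
have [e eb ec] := proper_surj (swap z (c d)) dS.
by move/(_ e); rewrite eb ec !eqxx.
Qed.

Let mateK z : involutive (mate z).
Proof.
move=> d; have [dS|dS] := boolP (base d \in S); first by rewrite !mate_in.
have [b1 c1] := mateP z dS; have dS' : base (mate z d) \notin S by rewrite b1.
have [b2 c2] := mateP z dS'.
by apply: (proj2 cS _ dS); rewrite ?b2 ?c2 ?b1 ?c1 ?swapK.
Qed.

Let mate_neq z d : base d \notin S -> c d != z -> mate z d != d.
Proof.
move=> dS /swap_neq; apply: contraNneq => E.
by have [_] := mateP z dS; rewrite E => <-.
Qed.

Let mate_col z d : (c (mate z d) == z) = (c d == z).
Proof.
have [dS|dS] := boolP (base d \in S); first by rewrite mate_in.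
by have [_ ->] := mateP z dS; rewrite swap_eq.
Qed.

Let mate_L z d : d \in L -> mate z d \in L.
Proof.
have [dS|dS] := boolP (base d \in S); first by rewrite mate_in.
by have [bm _] := mateP z dS; move=> _; apply: L_off; rewrite bm.
Qed.

(** The darts of [L] with a colour other than [z] are paired by [opp], and those among them based
    off [S] are paired by [mate z]. Both sets are even, hence so is their difference. *)
Lemma boundary_parity z :
  ~~ odd #|[set d | [&& d \in L, base d \in S & c d != z]]|.
Proof.
pose A := [set d | (d \in L) && (c d != z)].
pose B := [set d in A | base d \notin S].
have -> : [set d | [&& d \in L, base d \in S & c d != z]] = A :\: B.
  by apply/setP=> d; rewrite !inE; case: (d \in L) (c d != z) (base d \in S) => [] [] [].
rewrite cardsDS; last by apply/subsetP => d; rewrite !inE => /andP[].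
rewrite oddB; last by apply/subset_leq_card/subsetP => d; rewrite !inE => /andP[].
rewrite (negPf (@even_card_involution _ (@opp G) A _ _ _))
  ?(negPf (@even_card_involution _ (mate z) B _ _ _)) //.
- move=> d; rewrite !inE => /andP[/andP[dL dz] dS].
  by rewrite mate_L // mate_col dz; have [-> _] := mateP z dS.
- by move=> d; rewrite !inE => /andP[/andP[dL dz] dS]; apply: mate_neq.
- exact: oppK.
- by move=> d; rewrite !inE (proj1 cS) => /andP[/L_opp-> ->].
- by move=> d _; apply: opp_neq.
Qed.

(** The Kempe chain of [d] is its orbit under [opp] and [mate z]. Its darts based in [S] are the
    fixed points of [mate z] on it, namely [d] and one other dart [d']; the colours other than [z]
    are exchanged along the chain. *)
Lemma kempe_switch z d : d \in L -> base d \in S -> c d != z ->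
  exists (c' : dart G -> option bool) (d' : dart G),
    [/\ proper_off S c', [/\ d' \in L, base d' \in S, c d' != z & d' != d],
        c' d = swap z (c d), c' d' = swap z (c d') &
        forall e, e \in L -> base e \in S -> e != d -> e != d' -> c' e = c e].
Proof.
move=> dL dS dz.
have [X [y [dX yX yd ty [oX tX fX minX]]]] :=
  dihedral_orbit (@oppK G) (mateK z) (@opp_neq G) (mate_in z dS).
(* By minimality of the orbit, the chain neither leaves [L] nor meets the colour [z]. *)
have /subsetP XA : X \subset [set e | (e \in L) && (c e != z)].
  apply: minX => [|e|e]; first by rewrite inE dL.
    by rewrite !inE (proj1 cS) => /andP[/L_opp-> ->].
  by rewrite !inE mate_col => /andP[/mate_L-> ->].
have XL e : e \in X -> e \in L by move/XA; rewrite inE => /andP[].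
have Xz e : e \in X -> c e != z by move/XA; rewrite inE => /andP[].
have yS : base y \in S.
  by apply: contraT => yS; have := mate_neq yS (Xz _ yX); rewrite ty eqxx.
pose c' e := if e \in X then swap z (c e) else c e.
have oX' e : (opp e \in X) = (e \in X).
  by apply/idP/idP => /oX; rewrite ?oppK.
exists c', y; split; rewrite /c' ?dX ?yX ?XL ?Xz //; last first.
  move=> e eL eS ed ey; case: ifP => // /fX; rewrite mate_in // => /(_ erefl).
  by case=> E; rewrite E eqxx in ed ey.
split=> [e|x xS e f ex fx]; first by rewrite oX' (proj1 cS).
(* At a vertex off [S] the two darts of colours other than [z] are mates, so the chain contains both
   or neither. *)
have inX a b : base a = x -> base b = x -> a \in X -> c b != z -> b \in X.
  move=> ax bx aX bz; have aS : base a \notin S by rewrite ax.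
  have [|ab] := eqVneq (c a) (c b).
    by move/(proj2 cS _ xS) => <-.
  suff -> : b = mate z a by apply: tX.
  have [m1 m2] := mateP z aS; apply: (proj2 cS _ xS); rewrite ?m1 ?m2 //.
  by apply: swap_uniq => //; apply: Xz.
case: ifPn => eX; case: ifPn => fX' E; apply: (proj2 cS _ xS) => //.
- by apply: (can_inj (@swapK z)).
- case/negP: fX'; apply: (inX e) => //; rewrite -E swap_eq; exact: Xz.
- case/negP: eX; apply: (inX f) => //; rewrite E swap_eq; exact: Xz.
Qed.

End Kempe.
End DartColourings.

(** * Colourings away from a 5-circuit *)

(* Outer colours around a 5-circuit of which the first vertex is the one between
   the two singly occurring colours. *)
Definition centred (w1 w2 w3 w4 w5 : option bool) : bool :=
  [&& w3 == w1, w4 == w1 & uniq [:: w1; w2; w5]].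

Definition centred_somewhere w1 w2 w3 w4 w5 : bool :=
  [|| centred w1 w2 w3 w4 w5, centred w2 w3 w4 w5 w1, centred w3 w4 w5 w1 w2,
      centred w4 w5 w1 w2 w3 | centred w5 w1 w2 w3 w4].

(** By parity every colour occurs an odd number of times, hence the multiplicities are 3, 1 and 1.
    If the two single colours sit at neighbouring vertices, the circuit can be coloured; otherwise
    the pattern is centred at the vertex between them. *)
Lemma outer_colours w1 w2 w3 w4 w5 :
    (forall z, ~~ odd (count (predC1 z) [:: w1; w2; w3; w4; w5])) ->
  centred_somewhere w1 w2 w3 w4 w5 \/
  exists e1 e2 e3 e4 e5, [/\ uniq [:: e1; e5; w1], uniq [:: e2; e1; w2],
    uniq [:: e3; e2; w3], uniq [:: e4; e3; w4] & uniq [:: e5; e4; w5]].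
Proof.
pose cols := [:: None; Some true; Some false].
pose ext w1 w2 w3 w4 w5 := has (fun e1 => has (fun e2 => has (fun e3 => has (fun e4 =>
  has (fun e5 => [&& uniq [:: e1; e5; w1], uniq [:: e2; e1; w2],
    uniq [:: e3; e2; w3], uniq [:: e4; e3; w4] & uniq [:: e5; e4; w5]])
  cols) cols) cols) cols) cols.
move=> even; suff : centred_somewhere w1 w2 w3 w4 w5 || ext w1 w2 w3 w4 w5.
  case/orP=> [|ex]; [by left | right]; move: ex => /hasP[e1 _ /hasP[e2 _ /hasP[e3 _]]].
  move=> /hasP[e4 _ /hasP[e5 _ /and5P[*]]].
  by exists e1, e2, e3, e4, e5.
(* The hypothesis becomes a boolean, and the 243 cases are settled by computation. *)
have : [&& ~~ odd (count (predC1 None) [:: w1; w2; w3; w4; w5]),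
    ~~ odd (count (predC1 (Some true)) [:: w1; w2; w3; w4; w5])
  & ~~ odd (count (predC1 (Some false)) [:: w1; w2; w3; w4; w5])] by rewrite !even.
apply/implyP; case: w1 w2 w3 w4 w5 {even} => [[]|] [[]|] [[]|] [[]|] [[]|];
  vm_compute; reflexivity.
Qed.

Lemma uniq5P (T : eqType) (x1 x2 x3 x4 x5 : T) : uniq [:: x1; x2; x3; x4; x5] ->
  [/\ [/\ x1 <> x2, x1 <> x3, x1 <> x4 & x1 <> x5], [/\ x2 <> x3, x2 <> x4 & x2 <> x5],
      x3 <> x4, x3 <> x5 & x4 <> x5].
Proof.
rewrite /= !inE !negb_or -!andbA andbT => /and5P[/eqP? /eqP? /eqP? /eqP?].
by move=> /and5P[/eqP? /eqP? /eqP? /eqP? /andP[/eqP? /eqP?]]; split; try split.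
Qed.

Section Cubic.
Variable G : mgraph.
Hypothesis cubG : cubic G.
Implicit Types (c : dart G -> option bool) (x : vert G) (d e : dart G).

Definition third_dart d d' : dart G :=
  odflt d [pick e | [&& base e == base d, e != d & e != d']].

Lemma third_dartP d d' (o := third_dart d d') : base d' = base d -> d' != d ->
  [/\ base o = base d, o != d, o != d' &
      forall e, base e = base d -> [\/ e = d, e = d' | e = o]].
Proof.
move=> bd dd'; pose A := [set e | base e == base d].
have dA : d \in A by rewrite inE.
have d'A : d' \in A :\ d by rewrite !inE dd' bd eqxx.
have /eqP := cubG (base d); rewrite /degree -/A (cardsD1 d) dA (cardsD1 d') d'A.
rewrite !add1n !eqSS => /cards1P[o' /setP oA].
have o'A : [&& base o' == base d, o' != d & o' != d'].
  by have := oA o'; rewrite !inE eqxx => /and3P[-> -> ->].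
rewrite /o /third_dart; case: pickP => [e|/(_ o')]; last by rewrite o'A.
move=> /and3P[/eqP be ed ed'] /=; split=> // f bf.
have inO h : base h = base d -> h != d -> h != d' -> h = o'.
  by move=> bh hd hd'; have := oA h; rewrite !inE hd hd' bh eqxx => /esym/eqP.
have [->|fd] := eqVneq f d; first by constructor.
have [->|fd'] := eqVneq f d'; first by constructor.
by constructor 3; rewrite [f]inO // [e]inO.
Qed.

Definition off_edges (C : seq (dart G)) : {pred dart G} :=
  [pred d | edge_of d \notin [seq edge_of e | e <- C]].

Lemma off_edges_opp C d : d \in off_edges C -> opp d \in off_edges C.
Proof. by rewrite !inE edge_of_opp. Qed.

Section FiveCircuit.

Definition five d1 d2 d3 d4 d5 := circuit [:: d1; d2; d3; d4; d5].

Lemma five_rot d1 d2 d3 d4 d5 : five d1 d2 d3 d4 d5 -> five d2 d3 d4 d5 d1.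
Proof.
rewrite /five /circuit => /and4P[_ c1 b1 e1].
rewrite -[[:: d2; _; _; _; _]]/(rot 1 [:: d1; d2; d3; d4; d5]).
by rewrite rot_cycle !map_rot !rot_uniq c1 b1 e1.
Qed.

Lemma fiveP d1 d2 d3 d4 d5 :
  reflect
    ([/\ base (opp d1) = base d2, base (opp d2) = base d3, base (opp d3) = base d4,
         base (opp d4) = base d5 & base (opp d5) = base d1] /\
     uniq [:: base d1; base d2; base d3; base d4; base d5])
    (five d1 d2 d3 d4 d5).
Proof.
rewrite /five /circuit; apply: (iffP idP) => [/and4P[_ cyc ub _]|[[b1 b2 b3 b4 b5] ub]].
  by split=> //; move: cyc => /= /and5P[/eqP? /eqP? /eqP? /eqP? /andP[/eqP?]].
apply/and4P; split=> //; first by rewrite /= b1 b2 b3 b4 b5 !eqxx.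
(* Two equal edges would identify two of the five vertices. *)
move: ub; rewrite /= !inE !negb_or -!andbA !andbT.
move=> /and5P[/eqP ? /eqP ? /eqP ? /eqP ? /and5P[/eqP ? /eqP ? /eqP ? /eqP ?]].
move=> /andP[/eqP ? /eqP ?]; have := @oppK G => oK.
by do ![apply/andP; split]; apply/negP => /edge_ofP[] ?; congruence.
Qed.


(** Both ends of an edge of the circuit lie on the circuit. This is the hypothesis [L_off] of the
    Kempe lemmas. *)
Lemma five_off_edges (d1 d2 d3 d4 d5 d : dart G) : five d1 d2 d3 d4 d5 ->
  base d \notin [seq base e | e <- [:: d1; d2; d3; d4; d5]] ->
  d \in off_edges [:: d1; d2; d3; d4; d5].
Proof.
case/fiveP=> -[b1 b2 b3 b4 b5] _ bd; rewrite inE; apply: contra bd.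
case/mapP=> e; rewrite !inE => eC /eqP/edge_ofP[] ->.
  by case/or4P: eC => [||| /orP[]] /eqP->; rewrite eqxx ?orbT.
by case/or4P: eC => [||| /orP[]] /eqP->; rewrite ?(b1, b2, b3, b4, b5) eqxx ?orbT.
Qed.

(* The edge leaving the circuit at the start of [d], where [d'] precedes [d]. *)
Definition outer (d' d : dart G) := third_dart d (opp d').

Lemma outerP d1 d2 d3 d4 d5 (o := outer d5 d1) : five d1 d2 d3 d4 d5 ->
  [/\ base o = base d1, o \in off_edges [:: d1; d2; d3; d4; d5] &
      forall e, base e = base d1 -> [\/ e = d1, e = opp d5 | e = o]].
Proof.
move=> f; have [[b1 b2 b3 b4 b5] ub] := fiveP _ _ _ _ _ f.
have [[? ? ? ?] [? ? ?] ? ? ?] := uniq5P ub.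
have := @oppK G => oK.
have [|oN oE oE' cover] := @third_dartP d1 (opp d5) b5.
  by apply/eqP => ?; congruence.
split=> //; rewrite inE; apply/mapP => -[e]; rewrite !inE -/(outer d5 d1) -/o.
rewrite -/(outer d5 d1) -/o in oN oE oE'; move/eqP in oE; move/eqP in oE'.
by move=> eC /eqP/edge_ofP[] E;
   case/or4P: eC => [||| /orP[]] /eqP ?; congruence.
Qed.


(** The values have an arbitrary type because both colours and indicator functions of matchings are
    modified in this way. *)
Lemma recolour_five (T : Type) (d1 d2 d3 d4 d5 : dart G) (c : dart G -> T) k1 k2 k3 k4 k5 :
    five d1 d2 d3 d4 d5 -> opp_invariant c ->
  exists c' : dart G -> T, [/\ opp_invariant c',
    [/\ c' d1 = k1, c' d2 = k2, c' d3 = k3, c' d4 = k4 & c' d5 = k5]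
    & {in off_edges [:: d1; d2; d3; d4; d5], c' =1 c}].
Proof.
move=> /and4P[_ _ _ ue] co; pose C := [:: d1; d2; d3; d4; d5].
pose ks := [:: k1; k2; k3; k4; k5].
(* Off the circuit the index is 5, so [nth] falls back on its default [c d]. *)
pose c' d := nth (c d) ks (index (edge_of d) [seq edge_of e | e <- C]).
exists c'; split=> [d||d dC]; rewrite /c'.
- by rewrite edge_of_opp co.
- have E i : i < 5 -> index (edge_of (nth d1 C i)) [seq edge_of e | e <- C] = i.
    by move=> i5; rewrite -(nth_map d1 set0) // index_uniq ?size_map.
  by rewrite (E 0) // (E 1) // (E 2) // (E 3) // (E 4).
rewrite nth_default //; have := dC; rewrite inE -index_mem -leqNgt.
by rewrite size_map.
Qed.

Lemma proper_at_five (d1 d2 d3 d4 d5 : dart G) c :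
    five d1 d2 d3 d4 d5 -> opp_invariant c ->
  uniq [:: c d1; c d5; c (outer d5 d1)] -> proper_at c (base d1).
Proof.
move=> /outerP[_ _ cover] co; rewrite /= !inE negb_or -!andbA andbT.
case/and3P=> /eqP n1 /eqP n2 /eqP n3 d e /cover hd /cover he.
by case: hd => ->; case: he => ->; rewrite ?co => // E; congruence.
Qed.

Definition off_five d1 d2 d3 d4 d5 c :=
  proper_off [pred x | x \in [seq base e | e <- [:: d1; d2; d3; d4; d5]]] c.

Lemma off_five_rot (d1 d2 d3 d4 d5 : dart G) c :
  off_five d1 d2 d3 d4 d5 c -> off_five d2 d3 d4 d5 d1 c.
Proof.
move=> [co cP]; split=> // x; rewrite !inE => xS; apply: cP; rewrite !inE.
by apply: contra xS; case/or4P => [||| /orP[]] ->; rewrite ?orbT.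
Qed.

Lemma proper_off_eq (S : {pred vert G}) c c' (L : {pred dart G}) :
    (forall d, base d \notin S -> d \in L) -> {in L, c' =1 c} -> opp_invariant c' ->
  proper_off S c -> proper_off S c'.
Proof.
move=> LS cc' co' [_ cP]; split=> // x xS d e dx ex.
by rewrite !cc' ?LS ?dx ?ex //; apply: cP xS _ _ dx ex.
Qed.

Lemma colourable_five (d1 d2 d3 d4 d5 : dart G) c k1 k2 k3 k4 k5
    (w1 := c (outer d5 d1)) (w2 := c (outer d1 d2)) (w3 := c (outer d2 d3))
    (w4 := c (outer d3 d4)) (w5 := c (outer d4 d5)) :
    five d1 d2 d3 d4 d5 -> off_five d1 d2 d3 d4 d5 c ->
    [/\ uniq [:: k1; k5; w1], uniq [:: k2; k1; w2], uniq [:: k3; k2; w3],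
        uniq [:: k4; k3; w4] & uniq [:: k5; k4; w5]] ->
  colourable G.
Proof.
move=> f1 cP [u1 u2 u3 u4 u5]; apply/colourableP.
have [c' [co' [E1 E2 E3 E4 E5] cc']] := recolour_five k1 k2 k3 k4 k5 f1 (proj1 cP).
have f2 := five_rot f1; have f3 := five_rot f2.
have f4 := five_rot f3; have f5 := five_rot f4.
have oE e1 e2 e3 e4 e5 : five e1 e2 e3 e4 e5 ->
    [seq edge_of e | e <- [:: d1; d2; d3; d4; d5]] =i
      [seq edge_of e | e <- [:: e1; e2; e3; e4; e5]] ->
    c' (outer e5 e1) = c (outer e5 e1).
  by move=> /outerP[_ o _] E; apply: cc'; rewrite inE E.
exists c'; split=> // x _.
have [xC|xC] := boolP (x \in [seq base e | e <- [:: d1; d2; d3; d4; d5]]); last first.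
  by apply: (proj2 (proper_off_eq _ cc' co' cP)) => // d; apply: five_off_edges.
move: xC; rewrite !inE => /or4P[||| /orP[]] /eqP->.
- by apply: (proper_at_five f1); rewrite ?(oE _ _ _ _ _ f1) ?E1 ?E5 // => ?; rewrite !inE.
- apply: (proper_at_five f2); rewrite ?(oE _ _ _ _ _ f2) ?E2 ?E1 // => E; rewrite !inE.
  by do !case: eqP.
- apply: (proper_at_five f3); rewrite ?(oE _ _ _ _ _ f3) ?E3 ?E2 // => E; rewrite !inE.
  by do !case: eqP.
- apply: (proper_at_five f4); rewrite ?(oE _ _ _ _ _ f4) ?E4 ?E3 // => E; rewrite !inE.
  by do !case: eqP.
- apply: (proper_at_five f5); rewrite ?(oE _ _ _ _ _ f5) ?E5 ?E4 // => E; rewrite !inE.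
  by do !case: eqP.
Qed.

End FiveCircuit.
End Cubic.

(** Outer colours a, b, a, a, c after exchanging a and b at the second vertex and at one more. With
    the first or the fourth, the single colours become neighbours; with the third, the pattern a, a,
    b, a, c has its centre at the fourth vertex. *)
Lemma centred_swap w1 w2 w3 w4 w5 : centred w1 w2 w3 w4 w5 ->
  [/\ ~~ centred_somewhere (swap w5 w1) (swap w5 w2) w3 w4 w5,
      ~~ centred_somewhere w1 (swap w5 w2) w3 (swap w5 w4) w5
    & centred w4 w5 w1 (swap w5 w2) (swap w5 w3)].
Proof.
move=> /and3P[/eqP-> /eqP-> u].
have: uniq [:: w1; w2; w5] by [].
by case: w1 w2 w5 {u} => [[]|] [[]|] [[]|].
Qed.

(** * Moving the centre along a 5-circuit *)

Section Shift.
Variable G : mgraph.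
Hypothesis cubG : cubic G.
Implicit Types (c : dart G -> option bool) (x : vert G) (d e : dart G).

(** The outer darts are the boundary darts of the Kempe lemmas, with [S] the vertices of the circuit
    and [L] the darts off its edges. A chord contributes both of its darts. *)
Lemma outers_boundary d1 d2 d3 d4 d5 (C := [:: d1; d2; d3; d4; d5])
    (os := [:: outer d5 d1; outer d1 d2; outer d2 d3; outer d3 d4; outer d4 d5]) :
    five d1 d2 d3 d4 d5 ->
  uniq os /\
  forall d, (d \in os) = (d \in off_edges C) && (base d \in [seq base e | e <- C]).
Proof.
move=> f1; have f2 := five_rot f1; have f3 := five_rot f2.
have f4 := five_rot f3; have f5 := five_rot f4.
have [_ ub] := fiveP _ _ _ _ _ f1.
have bos : [seq base e | e <- os] = [seq base e | e <- C].
  have b e1 e2 e3 e4 e5 : five e1 e2 e3 e4 e5 -> base (outer e5 e1) = base e1.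
    by move/(outerP cubG) => -[].
  by rewrite /= (b _ _ _ _ _ f1) (b _ _ _ _ _ f2) (b _ _ _ _ _ f3)
    (b _ _ _ _ _ f4) (b _ _ _ _ _ f5).
split=> [|d]; first by apply: (@map_uniq _ _ (@base G)); rewrite bos.
apply/idP/andP => [dos|[dC]]; last first.
  have key e1 e2 e3 e4 e5 : five e1 e2 e3 e4 e5 -> e1 \in C -> e5 \in C ->
      base d = base e1 -> d = outer e5 e1.
    move=> /(outerP cubG)[_ _ cov] eC eC' /cov[] E //.
      by move: dC; rewrite inE E map_f.
    by move: dC; rewrite inE E edge_of_opp map_f.
  by rewrite !inE => /or4P[||| /orP[]] /eqP; [move/(key _ _ _ _ _ f1) | move/(key _ _ _ _ _ f2)
    | move/(key _ _ _ _ _ f3) | move/(key _ _ _ _ _ f4) | move/(key _ _ _ _ _ f5)] => ->;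
    rewrite ?inE ?eqxx ?orbT.
split; last by rewrite -bos map_f.
have key e1 e2 e3 e4 e5 : five e1 e2 e3 e4 e5 ->
    [seq edge_of e | e <- C] =i [seq edge_of e | e <- [:: e1; e2; e3; e4; e5]] ->
    outer e5 e1 \in off_edges C.
  by move=> /(outerP cubG)[_ o _] E; rewrite inE E.
rewrite !inE in dos; case/or4P: dos => [||| /orP[]] /eqP ->;
  [apply: (key _ _ _ _ _ f1) | apply: (key _ _ _ _ _ f2) | apply: (key _ _ _ _ _ f3)
  | apply: (key _ _ _ _ _ f4) | apply: (key _ _ _ _ _ f5)] => e; rewrite !inE; by do !case: eqP.
Qed.

Lemma outer_parity d1 d2 d3 d4 d5 c z :
    five d1 d2 d3 d4 d5 -> off_five d1 d2 d3 d4 d5 c ->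
  ~~ odd (count (predC1 z) [:: c (outer d5 d1); c (outer d1 d2); c (outer d2 d3);
                               c (outer d3 d4); c (outer d4 d5)]).
Proof.
move=> f cC; have [uos os] := outers_boundary f.
have := boundary_parity cubG cC (@off_edges_opp _ _) (fun d => five_off_edges f) z.
rewrite -[X in count _ X]/(map c
  [:: outer d5 d1; outer d1 d2; outer d2 d3; outer d3 d4; outer d4 d5]).
rewrite count_map -size_filter.
rewrite -(card_uniqP (filter_uniq _ uos)) cardsE; congr (~~ odd _); apply: eq_card => d.
by rewrite mem_filter os [RHS]andbC -andbA.
Qed.

Definition centred_colouring d1 d2 d3 d4 d5 c :=
  off_five d1 d2 d3 d4 d5 c /\
  centred (c (outer d5 d1)) (c (outer d1 d2)) (c (outer d2 d3)) (c (outer d3 d4))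
    (c (outer d4 d5)).

Hypothesis ncolG : ~ colourable G.

Lemma off_five_centred d1 d2 d3 d4 d5 c :
    five d1 d2 d3 d4 d5 -> off_five d1 d2 d3 d4 d5 c ->
  centred_somewhere (c (outer d5 d1)) (c (outer d1 d2)) (c (outer d2 d3))
    (c (outer d3 d4)) (c (outer d4 d5)).
Proof.
move=> f cC.
case: (outer_colours (fun z => outer_parity z f cC)) => // -[k1 [k2 [k3 [k4 [k5 kP]]]]].
by case: ncolG; apply: colourable_five f cC kP.
Qed.

(* The Kempe chain from the second vertex of the circuit in the two colours
   other than that of the fifth outer edge must end at the third vertex, since
   otherwise switching it makes the colouring extendable. *)
Lemma centred_shift d1 d2 d3 d4 d5 c :
    five d1 d2 d3 d4 d5 -> centred_colouring d1 d2 d3 d4 d5 c ->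
  exists c', centred_colouring d4 d5 d1 d2 d3 c'.
Proof.
move=> f [cC cent]; have [uos os] := outers_boundary f.
set o1 := outer d5 d1 in cent uos os; set o2 := outer d1 d2 in cent uos os.
set o3 := outer d2 d3 in cent uos os; set o4 := outer d3 d4 in cent uos os.
set o5 := outer d4 d5 in cent uos os.
have bd o : o \in [:: o1; o2; o3; o4; o5] ->
    o \in off_edges [:: d1; d2; d3; d4; d5] /\
    base o \in [seq base e | e <- [:: d1; d2; d3; d4; d5]].
  by rewrite os => /andP.
have [o2L o2S] : _ /\ _ := bd o2 ltac:(by rewrite !inE eqxx orbT).
have c25 : c o2 != c o5 by case/and3P: cent => _ _; rewrite /= !inE negb_or andbT => /andP[].
have [c' [d' [cC' [d'L d'S d'5 d'2] c'2 c'd c'E]]] :=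
  kempe_switch cubG cC (@off_edges_opp _ _) (fun d => five_off_edges f) o2L o2S c25.
have := off_five_centred f cC'; rewrite -/o1 -/o2 -/o3 -/o4 -/o5.
have d'os : d' \in [:: o1; o2; o3; o4; o5] by rewrite os d'L.
have c'o o : o \in [:: o1; o2; o3; o4; o5] ->
    c' o = if (o == o2) || (o == d') then swap (c o5) (c o) else c o.
  case: eqP => [-> //|/eqP n2] /=; case: eqP => [-> //|/eqP nd'] /bd[? ?].
  exact: c'E.
have [[n12 n13 n14 n15] [n23 n24 n25] n34 n35 n45] := uniq5P uos.
have [/negP sw1 /negP sw4 sw3] := centred_swap cent.
have C' k1 k2 k3 k4 k5 : c' o1 = k1 -> c' o2 = k2 -> c' o3 = k3 -> c' o4 = k4 ->
    c' o5 = k5 -> centred_somewhere (c' o1) (c' o2) (c' o3) (c' o4) (c' o5) =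
                  centred_somewhere k1 k2 k3 k4 k5.
  by move=> -> -> -> -> ->.
have ne (a b : dart G) : a <> b -> (a == b = false) * (b == a = false).
  by move=> ab; rewrite [b == a]eq_sym; split; apply/eqP.
have nes := (ne _ _ n12, ne _ _ n13, ne _ _ n14, ne _ _ n15, ne _ _ n23, ne _ _ n24,
             ne _ _ n25, ne _ _ n34, ne _ _ n35, ne _ _ n45).
have c'E' : [/\ c' o1 = if o1 == d' then swap (c o5) (c o1) else c o1,
    c' o3 = if o3 == d' then swap (c o5) (c o3) else c o3,
    c' o4 = if o4 == d' then swap (c o5) (c o4) else c o4
    & c' o5 = if o5 == d' then swap (c o5) (c o5) else c o5].
  by split; rewrite c'o ?inE ?eqxx ?orbT // nes.
(* The far end of the chain is not the second outer dart, where it starts, nor the fifth, whose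
   colour is the fixed one. The first and the fourth contradict [off_five_centred], so only the
   third remains. *)
case: c'E'; move: d'os d'2 d'5.
rewrite !inE => /or4P[||| /orP[]] /eqP->; rewrite ?eqxx // => _ _ E1 E3 E4 E5.
- by rewrite E1 E3 E4 E5 c'2 ?eqxx ?nes.
- move=> _; exists c'; split; last by rewrite E1 E3 E4 E5 c'2 ?eqxx ?nes.
  by do 3!apply: off_five_rot.
- by rewrite E1 E3 E4 E5 c'2 ?eqxx ?nes.
Qed.

Definition heavy_at d1 d2 d3 d4 d5 := exists c, centred_colouring d1 d2 d3 d4 d5 c.

(** Some vertex is the centre, and shifts by three steps reach all five vertices because 3 is prime
    to 5. *)
Lemma heavy_everywhere d1 d2 d3 d4 d5 c :
    five d1 d2 d3 d4 d5 -> off_five d1 d2 d3 d4 d5 c ->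
  [/\ heavy_at d1 d2 d3 d4 d5, heavy_at d2 d3 d4 d5 d1, heavy_at d3 d4 d5 d1 d2,
      heavy_at d4 d5 d1 d2 d3 & heavy_at d5 d1 d2 d3 d4].
Proof.
move=> f1 c1; have f2 := five_rot f1; have f3 := five_rot f2.
have f4 := five_rot f3; have f5 := five_rot f4.
have c2 := off_five_rot c1; have c3 := off_five_rot c2.
have c4 := off_five_rot c3; have c5 := off_five_rot c4.
have shift e1 e2 e3 e4 e5 : five e1 e2 e3 e4 e5 ->
    heavy_at e1 e2 e3 e4 e5 -> heavy_at e4 e5 e1 e2 e3.
  by move=> f [c' c'P]; apply: centred_shift f c'P.
have h14 := shift _ _ _ _ _ f1; have h25 := shift _ _ _ _ _ f2.
have h31 := shift _ _ _ _ _ f3; have h42 := shift _ _ _ _ _ f4.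
have h53 := shift _ _ _ _ _ f5.
have some : [\/ heavy_at d1 d2 d3 d4 d5, heavy_at d2 d3 d4 d5 d1, heavy_at d3 d4 d5 d1 d2
    | heavy_at d4 d5 d1 d2 d3 \/ heavy_at d5 d1 d2 d3 d4].
  case/or4P: (off_five_centred f1 c1) => [H|H|H|/orP[H|H]].
  - by constructor 1; exists c.
  - by constructor 2; exists c.
  - by constructor 3; exists c.
  - by constructor 4; left; exists c.
  - by constructor 4; right; exists c.
by case: some => [H|H|H|[H|H]]; split; auto 6.
Qed.
End Shift.

(** * Deletion of an edge and clusters *)

Section DelSuppress.
Variables (G : mgraph) (d0 : dart G).
Implicit Types (c : dart G -> option bool) (x : vert G) (d e : dart G).
Hypotheses (cubG : cubic G) (loopless : base d0 != base (opp d0)).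

Let H := del_edges [set edge_of d0].
Let ends := [pred x | (x == base d0) || (x == base (opp d0))].

Lemma edge_of_ends d : edge_of d = edge_of d0 -> base d \in ends.
Proof. by move/eqP/edge_ofP => [] ->; rewrite inE eqxx ?orbT. Qed.

Lemma degree_del_edge x : (@degree H x == 2) = (x \in ends).
Proof.
have -> : @degree H x = #|[set d | (base d == x) && (edge_of d != edge_of d0)]|.
  rewrite /degree -(card_imset _ val_inj) /=; apply: eq_card => d; rewrite !inE.
  apply/imsetP/idP => [[e]|/andP[dx de]].
    by rewrite inE => /eqP ex ->; have := valP e; rewrite inE ex eqxx.
  have de' : edge_of d \notin [set edge_of d0] by rewrite inE.
  by exists (Sub d de'); rewrite ?inE.
have key e : base e != base (opp e) ->
    #|[set d | (base d == base e) && (edge_of d != edge_of e)]| = 2.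
  move=> le; have := cubG (base e); rewrite /degree (cardsD1 e) inE eqxx => -[<-].
  apply: eq_card => d; rewrite !inE andbC.
  apply/andP/andP => [[de bd]|[de bd]]; split=> //.
    by apply: contraNneq de => ->.
  apply/negP => /edge_ofP[E|E]; first by rewrite E eqxx in de.
  by rewrite -(eqP bd) E eqxx in le.
have [xd|xd] := eqVneq x (base d0); first by rewrite xd key // inE !eqxx.
have [xd'|xd'] := eqVneq x (base (opp d0)).
  by rewrite xd' -edge_of_opp key ?oppK 1?eq_sym // inE !eqxx orbT.
rewrite !inE (negPf xd) (negPf xd') /=; apply/negP => /eqP deg.
have := cubG x; rewrite /degree; suff -> : [set d | base d == x] =
   [set d | (base d == x) && (edge_of d != edge_of d0)] by rewrite deg.
apply/setP => d; rewrite !inE; case: eqP => //= dx; apply/esym/negP => /eqP/edge_of_ends.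
by rewrite dx inE (negPf xd) (negPf xd').
Qed.

Lemma kept_del_edge (d : dart H) : kept d = (base (val d) \notin ends).
Proof. by rewrite /kept degree_del_edge. Qed.

(** The two remaining darts at each end of the deleted edge have the same colour, so walking
    straight through the 2-valent vertices keeps it and [c] descends to the suppressed graph. *)
Lemma colourable_del_suppress c : proper_off ends c ->
    (forall d e, base d \in ends -> base e = base d ->
       edge_of d != edge_of d0 -> edge_of e != edge_of d0 -> c d = c e) ->
  colourable (del_suppress d0).
Proof.
move=> [co cP] cE; apply/colourableP.
have c_turn (d : dart H) : c (val (turn d)) = c (val d).
  have [k|] := boolP (kept d); first by rewrite turn_kept.
  rewrite kept_del_edge negbK => dS.
  have ne (e : dart H) : edge_of (val e) != edge_of d0 by have := valP e; rewrite inE.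
  by apply/esym/cE => //; rewrite -[base _]/(@base H _) base_turn.
have c_step n (d : dart H) : c (val (iter n (@suppress_step H) d)) = c (val d).
  elim: n => //= n <-; rewrite -[in RHS]c_turn; exact: co.
exists (fun d : dart (del_suppress d0) => c (val (val d))); split=> [d|x _ d e dx ex].
  by rewrite /=; have [n [-> _ _]] := suppress_nextP (valP d); rewrite c_step.
have xN : base (val (val d)) \notin ends by rewrite -kept_del_edge (valP d).
move=> E; apply/val_inj/val_inj; apply: (cP _ xN) => //.
by rewrite -dx in ex; case: ex.
Qed.

(** Darts based away from the two ends survive the suppression, and their colours are pulled
    back. *)
Lemma proper_off_ends : colourable (del_suppress d0) -> exists c, proper_off ends c.
Proof.
case/colourableP => col [colo colP].
pose lift d : option (dart (del_suppress d0)) :=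
  obind (fun e : dart H => insub e) (insub d).
have liftK d s : lift d = Some s -> val (val s) = d.
  rewrite /lift; case: insubP => //= e _ <-; case: insubP => //= s' _ <-.
  by move=> [<-].
have liftS d : base d \notin ends -> exists s, lift d = Some s.
  move=> dS; have de : edge_of d \notin [set edge_of d0].
    by rewrite inE; apply: contraNneq dS => /edge_of_ends.
  rewrite /lift insubT /=; have k : kept (Sub d de : dart H) by rewrite kept_del_edge.
  by rewrite insubT; eexists.
(* An edge with only one end among [ends] takes the colour of its dart at the other end; an edge
   with both ends there gets the default [None]. *)
pose c d := if lift d is Some s then col s else
            if lift (opp d) is Some s then col s else None.
exists c; split=> [d|x xS d e dx ex]; last first.
  rewrite /c; have [s sE] : exists s, lift d = Some s by apply: liftS; rewrite dx.
  have [t tE] : exists s, lift e = Some s by apply: liftS; rewrite ex.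
  rewrite sE tE -(liftK _ _ sE) -(liftK _ _ tE) => E; congr (val (val _)).
  apply: (colP (base s)) => //; apply: val_inj.
  by rewrite /= (liftK _ _ sE) (liftK _ _ tE) dx ex.
rewrite /c oppK; case E: (lift d) => [s|]; case E': (lift (opp d)) => [t|] //.
(* Neither end of this edge is suppressed, so the walk that defines the opposite dart stops after
   one step. *)
suff -> : t = opp s by rewrite colo.
have vt : val t = opp (turn (val s)).
  rewrite turn_kept ?(valP s) //; apply: val_inj => /=.
  by rewrite (liftK _ _ E) (liftK _ _ E').
have st : iter 1 (@suppress_step H) (val s) = val t by rewrite vt.
apply: val_inj; rewrite -[RHS]/(suppress_next (val s)).
by rewrite (@suppress_nextE _ _ 0) ?st ?(valP s) ?(valP t).
Qed.
End DelSuppress.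

(** * From heavy 5-circuits to heavy clusters *)

Section Clusters.
Variable G : mgraph.
Implicit Types (c : dart G -> option bool) (x : vert G) (d e : dart G).
Hypotheses (cubG : cubic G) (ncolG : ~ colourable G).

Lemma del_suppress_edge d e : edge_of d = edge_of e -> del_suppress d = del_suppress e.
Proof. by rewrite /del_suppress => ->. Qed.

Lemma centred_del_suppress d1 d2 d3 d4 d5 :
    five d1 d2 d3 d4 d5 -> heavy_at d1 d2 d3 d4 d5 -> colourable (del_suppress d3).
Proof.
move=> f1 [c [cC cent]]; have f2 := five_rot f1; have f3 := five_rot f2.
have f4 := five_rot f3; have f5 := five_rot f4.
have [[b1 b2 b3 b4 b5] ub] := fiveP _ _ _ _ _ f1.
have [[n12 n13 n14 n15] [n23 n24 n25] n34 n35 n45] := uniq5P ub.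
pose w1 := c (outer d5 d1); pose w2 := c (outer d1 d2); pose w5 := c (outer d4 d5).
(* With outer colours a, b, a, a, c the circuit receives c, a, a, a, b. This is proper at the first,
   second and fifth vertices; at both ends of [d3], the edge opposite to the centre, the other two
   edges have colour a. *)
have [c' [co' [E1 E2 E3 E4 E5] cc']] := recolour_five w5 w1 w1 w1 w2 f1 (proj1 cC).
have [uos os] := outers_boundary cubG f1.
have oE o : o \in [:: outer d5 d1; outer d1 d2; outer d2 d3; outer d3 d4; outer d4 d5] ->
    c' o = c o by rewrite os => /andP[/cc'].
have := cent; rewrite /centred => /and3P[/eqP w3 /eqP w4].
rewrite -/w1 -/w2 -/w5 /= !inE negb_or andbT => /andP[/andP[n1 n2] n3].
have o1 : c' (outer d5 d1) = w1 by rewrite oE ?inE ?eqxx.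
have o2 : c' (outer d1 d2) = w2 by rewrite oE ?inE ?eqxx ?orbT.
have o3 : c' (outer d2 d3) = w1 by rewrite oE ?inE ?eqxx ?orbT // w3.
have o4 : c' (outer d3 d4) = w1 by rewrite oE ?inE ?eqxx ?orbT // w4.
have o5 : c' (outer d4 d5) = w5 by rewrite oE ?inE ?eqxx ?orbT.
apply: (@colourable_del_suppress G d3 cubG _ c'); rewrite ?b3; first by apply/eqP.
  split=> // x; rewrite inE negb_or => /andP[x3 x4].
  have [xC|xC] := boolP (x \in [seq base e | e <- [:: d1; d2; d3; d4; d5]]); last first.
    apply: (proj2 (proper_off_eq _ cc' co' cC)) => // d; exact: five_off_edges.
  move: xC; rewrite !inE (negPf x3) (negPf x4) /= => /or3P[] /eqP->.
  - by apply: (proper_at_five cubG f1); rewrite // E1 E5 o1 /= !inE negb_or eq_sym n3 eq_sym n2 eq_sym n1.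
  - by apply: (proper_at_five cubG f2); rewrite // E2 E1 o2 /= !inE negb_or n2 n1 eq_sym n3.
  - by apply: (proper_at_five cubG f5); rewrite // E5 E4 o5 /= !inE negb_or eq_sym n1 n3 n2.
have key d : (base d == base d3) || (base d == base d4) -> edge_of d != edge_of d3 -> c' d = w1.
  case/orP=> /eqP; [have [_ _ cov] := outerP cubG f3 | have [_ _ cov] := outerP cubG f4].
    by case/cov=> -> //; rewrite co'.
  by case/cov=> -> //; rewrite edge_of_opp eqxx.
move=> d e; rewrite inE => dS ed dd de; rewrite !key //.
by rewrite ed.
Qed.

(** The right-hand side does not mention [d], so one removable edge makes the whole circuit
    removable. From right to left, the centre is moved to the vertex opposite [d]. *)
Lemma five_del_suppressP d1 d2 d3 d4 d5 d : five d1 d2 d3 d4 d5 ->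
    d \in [:: d1; d2; d3; d4; d5] ->
  colourable (del_suppress d) <-> exists c, off_five d1 d2 d3 d4 d5 c.
Proof.
move=> f1; have f2 := five_rot f1; have f3 := five_rot f2.
have f4 := five_rot f3; have f5 := five_rot f4.
have [[b1 b2 b3 b4 b5] ub] := fiveP _ _ _ _ _ f1.
have [[n12 n13 n14 n15] [n23 n24 n25] n34 n35 n45] := uniq5P ub.
move=> dC; split=> [|[c /(heavy_everywhere cubG ncolG f1)[h1 h2 h3 h4 h5]]]; last first.
  move: dC; rewrite !inE => /or4P[||| /orP[]] /eqP->;
  [apply: centred_del_suppress f4 _ | apply: centred_del_suppress f5 _
  |apply: centred_del_suppress f1 _ | apply: centred_del_suppress f2 _
  |apply: centred_del_suppress f3 _]; by [].
have bd : base d != base (opp d).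
  by move: dC; rewrite !inE => /or4P[||| /orP[]] /eqP->;
    rewrite ?(b1, b2, b3, b4, b5); apply/eqP => //; apply: nesym.
move=> /(proper_off_ends cubG bd)[c [co cP]]; exists c; split=> // x xS; apply: cP.
apply: contra xS; rewrite !inE; move: dC; rewrite !inE.
by case/or4P=> [||| /orP[]] /eqP-> /orP[] /eqP->; rewrite ?(b1, b2, b3, b4, b5) eqxx ?orbT.
Qed.

Lemma five_at d1 d2 d3 d4 d5 x : five d1 d2 d3 d4 d5 ->
    x \in [seq base e | e <- [:: d1; d2; d3; d4; d5]] ->
  exists e1 e2 e3 e4 e5, [/\ five e1 e2 e3 e4 e5, base e1 = x &
    forall c, off_five d1 d2 d3 d4 d5 c <-> off_five e1 e2 e3 e4 e5 c].
Proof.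
move=> f1; have f2 := five_rot f1; have f3 := five_rot f2.
have f4 := five_rot f3; have f5 := five_rot f4.
rewrite !inE => /or4P[||| /orP[]] /eqP ->.
- by exists d1, d2, d3, d4, d5.
- exists d2, d3, d4, d5, d1; split=> // c; split=> h; first exact: off_five_rot.
  by do 4!apply: off_five_rot.
- exists d3, d4, d5, d1, d2; split=> // c; split=> h; first by do 2!apply: off_five_rot.
  by do 3!apply: off_five_rot.
- exists d4, d5, d1, d2, d3; split=> // c; split=> h; first by do 3!apply: off_five_rot.
  by do 2!apply: off_five_rot.
exists d5, d1, d2, d3, d4; split=> // c; split=> h; last by apply: off_five_rot.
by do 4!apply: off_five_rot.
Qed.

(** The position of the centre is left open, since [heavy_everywhere] can put it at any vertex of
    the circuit. *)
Definition heavy_vertex x := exists d1 d2 d3 d4 d5 c,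
  [/\ five d1 d2 d3 d4 d5, base d1 = x & off_five d1 d2 d3 d4 d5 c].

(* Two 5-circuits through the same vertex of a cubic graph share an edge. *)
Lemma heavy_vertex_five x e1 e2 e3 e4 e5 : heavy_vertex x -> five e1 e2 e3 e4 e5 ->
    x \in [seq base e | e <- [:: e1; e2; e3; e4; e5]] ->
  exists c, off_five e1 e2 e3 e4 e5 c.
Proof.
move=> [d1 [d2 [d3 [d4 [d5 [c [fd bd cP]]]]]]] /five_at h /h{h}.
case=> a1 [a2 [a3 [a4 [a5 [fa ba offE]]]]].
suff [c' c'P] : exists c', off_five a1 a2 a3 a4 a5 c' by exists c'; apply/offE.
have [_ _ cov] := outerP cubG fd; rewrite bd in cov.
have [[b1 b2 b3 b4 b5] ub] := fiveP _ _ _ _ _ fa.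
have [[n12 n13 n14 n15] [n23 n24 n25] n34 n35 n45] := uniq5P ub.
have col d : d \in [:: d1; d2; d3; d4; d5] -> colourable (del_suppress d).
  by move=> dC; apply/(five_del_suppressP fd dC); exists c.
have dl a d : edge_of a = edge_of d -> d \in [:: d1; d2; d3; d4; d5] ->
    a \in [:: a1; a2; a3; a4; a5] -> exists c', off_five a1 a2 a3 a4 a5 c'.
  move=> ad /col; rewrite -(del_suppress_edge ad) => cola aC.
  exact/(five_del_suppressP fa aC).
have ea5 d : opp a5 = d -> edge_of a5 = edge_of d by move=> <-; rewrite edge_of_opp.
(* Both [a1] and [opp a5] start at x, where only one dart is off the first circuit; so one of them
   runs along an edge of that circuit. *)
case: (cov a1 ba) => E1; first by apply: (dl a1 d1); rewrite ?E1 ?inE ?eqxx.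
  by apply: (dl a1 d5); rewrite ?E1 ?edge_of_opp ?inE ?eqxx ?orbT.
have := cov (opp a5); rewrite b5 ba => /(_ erefl)[] E5.
- by apply: (dl a5 d1); rewrite ?(ea5 _ E5) ?inE ?eqxx ?orbT.
- by apply: (dl a5 d5); rewrite ?(ea5 _ E5) ?edge_of_opp ?inE ?eqxx ?orbT.
case: n25; rewrite -b1 E1 -E5 oppK //.
Qed.

Lemma five_cyclesP (E : {set {set dart G}}) : reflect
  (exists d1 d2 d3 d4 d5, five d1 d2 d3 d4 d5 /\
     E = [set edge_of d | d in [:: d1; d2; d3; d4; d5]])
  (E \in five_cycles G).
Proof.
apply: (iffP imsetP) => [[[[|d1 [|d2 [|d3 [|d4 [|d5 []]]]]] // sz] fC ->]|].
  by exists d1, d2, d3, d4, d5; split; first by rewrite inE in fC.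
case=> d1 [d2 [d3 [d4 [d5 [fC ->]]]]].
exists [tuple d1; d2; d3; d4; d5]; first by rewrite inE.
by apply/setP=> E'; apply/imsetP/imsetP => -[e eC ->]; exists e.
Qed.

Lemma five_ends d1 d2 d3 d4 d5 d : five d1 d2 d3 d4 d5 ->
    edge_of d \in [set edge_of e | e in [:: d1; d2; d3; d4; d5]] ->
  base d \in [seq base e | e <- [:: d1; d2; d3; d4; d5]].
Proof.
move=> f; case/imsetP=> e eC dE; apply: contraT => /(five_off_edges f).
by rewrite inE dE map_f.
Qed.

Lemma union_of_five_cyclesP (H : {set {set dart G}}) d :
    union_of_five_cycles H -> edge_of d \in H ->
  exists d1 d2 d3 d4 d5, [/\ five d1 d2 d3 d4 d5,
    edge_of d \in [set edge_of e | e in [:: d1; d2; d3; d4; d5]] &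
    [set edge_of e | e in [:: d1; d2; d3; d4; d5]] \subset H].
Proof.
case/existsP=> F /and3P[_ /subsetP F5 /eqP->] /bigcupP[E EF dE].
have [d1 [d2 [d3 [d4 [d5 [f EE]]]]]] := five_cyclesP _ (F5 _ EF).
by exists d1, d2, d3, d4, d5; rewrite -EE; split=> //; apply: bigcup_sup.
Qed.

(** From left to right, the given circuit is enlarged to a cluster. Each edge of the cluster lies on
    a 5-circuit, which becomes heavy as soon as it meets a heavy vertex, so heaviness spreads along
    paths. *)
Lemma heavy_clusterP v : heavy_vertex v <->
  exists2 H : {set {set dart G}}, heavy_cluster H & v \in vertices_of H.
Proof.
split=> [hv|[H [Hmax Hcol] /imsetP[d dH ->]]]; last first.
  have /andP[HU _] := maxsetp Hmax; rewrite inE in dH.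
  have [d1 [d2 [d3 [d4 [d5 [f dC CH]]]]]] := union_of_five_cyclesP HU dH.
  have /imsetP[e eC dE] := dC.
  have cole : colourable (del_suppress e) by apply: Hcol; rewrite -dE.
  have [c cP] := proj1 (five_del_suppressP f eC) cole.
  have [e1 [e2 [e3 [e4 [e5 [fe be offE]]]]]] := five_at f (five_ends f dC).
  by exists e1, e2, e3, e4, e5, c; split=> //; apply/offE.
have [d1 [d2 [d3 [d4 [d5 [c [f bv cP]]]]]]] := hv.
pose E := [set edge_of e | e in [:: d1; d2; d3; d4; d5]].
have EP : union_of_five_cycles E && connected_in E.
  apply/andP; split.
    apply/existsP; exists [set E]; rewrite /cover big_set1 eqxx andbT.
    apply/andP; split; first by apply/set0Pn; exists E; rewrite inE.
    by rewrite sub1set; apply/five_cyclesP; exists d1, d2, d3, d4, d5.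
  apply/forall_inP => x /imsetP[dx]; rewrite inE => /(five_ends f) xC ->.
  apply/forall_inP => y /imsetP[dy]; rewrite inE => /(five_ends f) yC ->.
  apply: connect_cycle xC yC.
  have [[b1 b2 b3 b4 b5] _] := fiveP _ _ _ _ _ f.
  have step a b : a \in [:: d1; d2; d3; d4; d5] -> base (opp a) = base b ->
      adj_in E (base a) (base b).
    by move=> aC ab; apply/existsP; exists a; rewrite ab !eqxx !andbT imset_f.
  by rewrite /= !step // !inE eqxx ?orbT.
have [H Hmax EH] :=
  @maxset_exists _ (fun A => union_of_five_cycles A && connected_in A) E EP.
have /andP[HU HC] := maxsetp Hmax.
have vH : v \in vertices_of H.
  by apply/imsetP; exists d1; rewrite // inE (subsetP EH) // imset_f // inE eqxx.
have spread x y : adj_in H x y -> heavy_vertex x -> heavy_vertex y.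
  case/existsP=> d /and3P[dH /eqP<- /eqP<-] hx.
  have [e1 [e2 [e3 [e4 [e5 [fe dC _]]]]]] := union_of_five_cyclesP HU dH.
  have [c' c'P] := heavy_vertex_five hx fe (five_ends fe dC).
  rewrite -edge_of_opp in dC.
  have [a1 [a2 [a3 [a4 [a5 [fa ba offE]]]]]] := five_at fe (five_ends fe dC).
  by exists a1, a2, a3, a4, a5, c'; split=> //; apply/offE.
exists H => //; split=> // d dH.
have bH : base d \in vertices_of H by apply/imsetP; exists d; rewrite ?inE.
have {bH vH} /connectP[p pth bl] := forall_inP (forall_inP HC _ vH) _ bH.
have hd : heavy_vertex (base d).
  by rewrite bl; elim: p v hv pth {bl bv} => //= y p IH x hx /andP[/spread/(_ hx)/IH].
have [e1 [e2 [e3 [e4 [e5 [fe dC _]]]]]] := union_of_five_cyclesP HU dH.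
have [c' c'P] := heavy_vertex_five hd fe (five_ends fe dC).
have /imsetP[e eC dE] := dC; rewrite (del_suppress_edge dE).
by apply/(five_del_suppressP fe eC); exists c'.
Qed.
End Clusters.

(** * Matchings and the defect *)

Definition one3 (a b c : bool) : bool := a + b + c == 1.

Section Matchings.
Variable G : mgraph.
Implicit Types (x : vert G) (d e : dart G) (m : dart G -> bool).

Definition star x d1 d2 d3 : Prop :=
  [/\ base d1 = x, base d2 = x, base d3 = x, uniq [:: d1; d2; d3] &
      forall e, base e = x -> [\/ e = d1, e = d2 | e = d3]].

Definition exactly_one m x : Prop :=
  exists d, [/\ base d = x, m d & forall e, base e = x -> m e -> e = d].

(** A perfect matching given by its indicator function on darts, which allows boolean case analysis
    at each vertex; the lemmas below translate from and to sets of edges. *)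
Definition matching m : Prop :=
  opp_invariant m /\ forall x, exactly_one m x.

Lemma exactly_one_star m x d1 d2 d3 : star x d1 d2 d3 ->
  exactly_one m x <-> one3 (m d1) (m d2) (m d3).
Proof.
case=> b1 b2 b3; rewrite /= !inE negb_or andbT => /andP[/andP[n12 n13] n23] cov.
have nes := (negPf n12, negPf n13, negPf n23).
have nes' : ((d2 == d1) = false) * ((d3 == d1) = false) * ((d3 == d2) = false).
  by rewrite (eq_sym d2) !(eq_sym d3) !nes.
rewrite /one3; split=> [[d [bd md dm]]|].
  have sel e : base e = x -> m e = (e == d).
    by move=> be; apply/idP/eqP => [/(dm _ be)//|->].
  by rewrite !sel //; case: (cov d bd) => ->; rewrite eqxx ?nes ?nes'.
case E1: (m d1); case E2: (m d2); case E3: (m d3) => // _.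
- by exists d1; split=> // e /cov[] ->; rewrite ?E1 ?E2 ?E3.
- by exists d2; split=> // e /cov[] ->; rewrite ?E1 ?E2 ?E3.
- by exists d3; split=> // e /cov[] ->; rewrite ?E1 ?E2 ?E3.
Qed.

Lemma perfect_matching_matching (M : {set {set dart G}}) :
  perfect_matching M -> matching (fun d => edge_of d \in M).
Proof.
case/andP=> _ /forallP MP; split=> [d|x]; first by rewrite edge_of_opp.
have /cards1P[d dE] := MP x; have := set11 d; rewrite -dE inE => /andP[/eqP bd dM].
exists d; split=> // e be eM; apply/set1P; rewrite -dE inE be eqxx eM //.
Qed.

Definition edge_set m : {set {set dart G}} := [set edge_of d | d : dart G & m d].

Lemma mem_edge_set m d : opp_invariant m -> (edge_of d \in edge_set m) = m d.
Proof.
move=> mo; apply/imsetP/idP => [[e]|md]; last by exists d; rewrite ?inE.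
by rewrite inE => me /eqP/edge_ofP[] ->; rewrite ?mo.
Qed.

Lemma matching_perfect_matching m : matching m -> perfect_matching (edge_set m).
Proof.
case=> mo mP; apply/andP; split.
  by apply/subsetP=> E /imsetP[d _ ->]; apply: imset_f.
apply/forallP=> x; have [d [bd md dm]] := mP x; apply/cards1P; exists d.
apply/setP=> e; rewrite !inE mem_edge_set //; apply/andP/eqP => [[/eqP be me]|->].
  exact: dm.
by rewrite bd eqxx.
Qed.

Lemma defect_le (A : array3 G) : is_array3 A -> defect G <= #|uncovered A|.
Proof.
rewrite /defect => AP; have: A \in index_enum (array3 G) by rewrite mem_index_enum.
elim: (index_enum _) => // B r IH; rewrite inE big_cons => /predU1P[<-|/IH le].
  by rewrite AP geq_minl.
by case: ifP => // _; apply: leq_trans le; apply: geq_minr.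
Qed.

Lemma defect_ge k : k <= #|edges G| ->
  (forall A : array3 G, is_array3 A -> k <= #|uncovered A|) -> k <= defect G.
Proof.
move=> kE kA; apply: (big_ind (leq k)) => // a b ka kb.
by rewrite leq_min ka kb.
Qed.

(** The strict inequality rules out the default value of the minimum. *)
Lemma defect_attained : defect G < #|edges G| ->
  exists2 A : array3 G, is_array3 A & #|uncovered A| = defect G.
Proof.
move=> lt; suff [E|//] : defect G = #|edges G| \/
    exists2 A : array3 G, is_array3 A & #|uncovered A| = defect G.
  by rewrite E ltnn in lt.
rewrite /defect; apply: (big_ind (fun n => n = #|edges G| \/
    exists2 A : array3 G, is_array3 A & #|uncovered A| = n)) => [|a b ha hb|A AP].
- by left.
- by rewrite /minn; case: ifP.
- by right; exists A.
Qed.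

Definition uncovered_by (ms : seq (dart G -> bool)) d := all (fun m => ~~ m d) ms.

Lemma uncoveredP (A : array3 G) d :
  reflect (forall i, edge_of d \notin A i) (edge_of d \in uncovered A).
Proof.
rewrite !inE [_ \in edges _]imset_f // andbT; apply: (iffP negP) => [nb i|nb /bigcupP[i _]].
  by apply/negP => di; apply: nb; apply/bigcupP; exists i.
by apply/negP.
Qed.

Lemma defect_le_matchings m1 m2 m3 : matching m1 -> matching m2 -> matching m3 ->
  defect G <= #|edge_set (uncovered_by [:: m1; m2; m3])|.
Proof.
move=> h1 h2 h3; pose A : array3 G := [ffun i : 'I_3 => edge_set (nth m3 [:: m1; m2; m3] i)].
have mP (i : nat) : matching (nth m3 [:: m1; m2; m3] i).
  by case: i => [|[|[|i]]] //=; rewrite nth_nil.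
apply: leq_trans (defect_le (A := A) _) _.
  by apply/forallP=> i; rewrite ffunE; apply: matching_perfect_matching.
apply/subset_leq_card/subsetP=> E EU; have := EU; rewrite inE => /andP[_ /imsetP[d _ Ed]].
move: EU; rewrite Ed => /uncoveredP dU; apply: imset_f; rewrite inE /uncovered_by /=.
have {}dU (i : 'I_3) : ~~ nth m3 [:: m1; m2; m3] i d.
  by have := dU i; rewrite ffunE mem_edge_set //; apply: (proj1 (mP i)).
by rewrite (dU (@Ordinal 3 0 isT)) (dU (@Ordinal 3 1 isT)) (dU (@Ordinal 3 2 isT)).
Qed.

(** Turns a bound on the number of uncovered edges into one on lists of darts, the form used when
    counting around the triangle. *)
Lemma size_le_uncovered (A : array3 G) (s : seq (dart G)) :
  uniq [seq edge_of d | d <- s] -> all (fun d => edge_of d \in uncovered A) s ->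
  size s <= #|uncovered A|.
Proof.
move=> us sA; rewrite -(size_map (@edge_of G)) -(card_uniqP us).
apply/subset_leq_card/subsetP=> E /mapP[d ds ->]; exact: (allP sA).
Qed.

End Matchings.

(** * Short circuits excluded by the girth *)

Section Girth.
Variable G : mgraph.
Hypothesis girthG : girth_at_least G 5.
Implicit Types (d e : dart G).

Lemma girth_loop d : base (opp d) <> base d.
Proof. by move=> E; have := girthG (c := [:: d]); rewrite /circuit /= E eqxx => /(_ isT). Qed.

Lemma girth_parallel d e : base d = base e -> base (opp d) = base (opp e) -> d = e.
Proof.
move=> b1 b2; apply/eqP; apply: contraT => /eqP ne.
have := girthG (c := [:: d; opp e]); rewrite /circuit /= oppK b1 b2 !eqxx !inE !andbT /=.
rewrite edge_of_opp; have -> : base e != base (opp e) by apply/eqP=> /esym; apply: girth_loop.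
suff -> : edge_of d != edge_of e by move/(_ isT).
apply/negP=> /edge_ofP[] // E; apply: (@girth_loop e).
by rewrite -E b1.
Qed.

Lemma girth_triangle d1 d2 d3 : base (opp d1) = base d2 -> base (opp d2) = base d3 ->
  base (opp d3) = base d1 -> False.
Proof.
move=> b1 b2 b3; have absurd : ~~ circuit [:: d1; d2; d3] by apply/negP => /girthG.
have l1 := @girth_loop d1; have l2 := @girth_loop d2; have l3 := @girth_loop d3.
have uE : uniq [seq edge_of e | e <- [:: d1; d2; d3]].
  rewrite /= !inE !negb_or; have := @oppK G => oK.
  by do ![apply/andP; split] => //; apply/negP => /edge_ofP[] ?; congruence.
have uB : uniq [seq base e | e <- [:: d1; d2; d3]].
  rewrite /= !inE !negb_or.
  by do ![apply/andP; split] => //; apply/eqP; congruence.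
by case/negP: absurd; rewrite /circuit uE uB /= b1 b2 b3 !eqxx.
Qed.

Lemma girth_square d1 d2 d3 d4 : base (opp d1) = base d2 -> base (opp d2) = base d3 ->
  base (opp d3) = base d4 -> base (opp d4) = base d1 ->
  base d1 <> base d3 -> base d2 <> base d4 -> False.
Proof.
move=> b1 b2 b3 b4 n13 n24; have absurd : ~~ circuit [:: d1; d2; d3; d4] by apply/negP => /girthG.
have l1 := @girth_loop d1; have l2 := @girth_loop d2; have l3 := @girth_loop d3.
have l4 := @girth_loop d4.
have uE : uniq [seq edge_of e | e <- [:: d1; d2; d3; d4]].
  rewrite /= !inE !negb_or; have := @oppK G => oK.
  by do ![apply/andP; split] => //; apply/negP => /edge_ofP[] ?; congruence.
have uB : uniq [seq base e | e <- [:: d1; d2; d3; d4]].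
  rewrite /= !inE !negb_or.
  by do ![apply/andP; split] => //; apply/eqP; congruence.
by case/negP: absurd; rewrite /circuit uE uB /= b1 b2 b3 b4 !eqxx.
Qed.
End Girth.

(** * Inflation of a vertex *)

Section Inflation.
Variables (K : mgraph) (v : vert K).
Hypothesis cubK : cubic K.
Local Notation G := (inflate v).
Local Notation old d := (inl d : dart G).
Implicit Types (d e : dart K) (p q r : darts_at v).

Lemma star_third d e : base e = base d -> e != d -> star (base d) d e (third_dart d e).
Proof.
move=> ed ne; have [b n1 n2 cov] := third_dartP cubK ed ne.
by split=> //; rewrite /= !inE negb_or andbT -!andbA eq_sym ne eq_sym n1 eq_sym n2.
Qed.

Lemma star_at d : exists d' d'', star (base d) d d' d''.
Proof.
suff [e be ne] : exists2 e, base e = base d & e != d.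
  by exists e, (third_dart d e); apply: star_third.
have dA : d \in [set e | base e == base d] by rewrite inE.
have := cubK (base d); rewrite /degree (cardsD1 d) dA add1n => -[h].
have /card_gt0P[e] : 0 < #|[set e | base e == base d] :\ d| by rewrite h.
by rewrite !inE => /andP[ne /eqP be]; exists e.
Qed.

Lemma base_old_at p : base (old (val p)) = inr p.
Proof.
(* The match in [inflate_base] depends on the proof given by [boolP], so the claim is generalised
   over it. *)
have key b (s : alt_spec (base (val p) == v) (base (val p) == v) b) :
    match s with
    | AltTrue h => inr (Sub (val p) h)
    | AltFalse h => inl (Sub (base (val p)) h)
    end = inr p :> inflate_vert v.
  by case: s => h; [congr inr; apply: val_inj | case/negP: h; exact: (valP p)].
exact: key (boolP _).
Qed.

Lemma base_old_off d (h : base d != v) : base (old d) = inl (Sub (base d) h).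
Proof.
have key b (s : alt_spec (base d == v) (base d == v) b) :
    match s with
    | AltTrue h => inr (Sub d h)
    | AltFalse h => inl (Sub (base d) h)
    end = inl (Sub (base d) h) :> inflate_vert v.
  by case: s => h'; [case/negP: (h) | rewrite (bool_irrelevance h h')].
exact: key (boolP _).
Qed.

Lemma base_old_eq d e : base d != v -> (base (old e) = base (old d)) <-> base e = base d.
Proof.
move=> dv; rewrite (base_old_off dv); split=> [|ed].
  have [ev|ev] := eqVneq (base e) v; last by rewrite (base_old_off ev) => -[].
  have /eqP ev' := ev.
  by rewrite -[e]/(val (Sub e ev' : darts_at v)) base_old_at.
have ev : base e != v by rewrite ed.
by rewrite (base_old_off ev); congr inl; apply: val_inj.
Qed.

Lemma star_old d d' d'' : base d != v -> star (base d) d d' d'' ->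
  star (base (old d)) (old d) (old d') (old d'').
Proof.
move=> dv [_ b' b'' u cov]; split=> //; try by apply/base_old_eq.
move=> [e|[[p q] pq]]; last by rewrite (base_old_off dv).
by move/(base_old_eq _ dv)/cov => -[] ->; [constructor 1 | constructor 2 | constructor 3].
Qed.

(** A cyclic orientation of the triangle, packaged with the local facts about it: the stars of its
    vertices and the splitting of the edges into old ones and those of the triangle. *)
Definition triangle p q r (pq qr rp : dart G) : Prop :=
  [/\ star (inr p : vert G) (old (val p)) pq (opp rp),
      star (inr q : vert G) (old (val q)) qr (opp pq)
    & star (inr r : vert G) (old (val r)) rp (opp qr)] /\
  [/\ uniq [:: edge_of pq; edge_of qr; edge_of rp],
      forall d, edge_of (old d) \notin [:: edge_of pq; edge_of qr; edge_of rp]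
    & forall x : dart G, (exists d, x = old d) \/
        edge_of x \in [:: edge_of pq; edge_of qr; edge_of rp]].

Definition new p q (h : p != q) : dart G := inr (Sub (p, q) h).

Lemma new_star p q r (pq : p != q) (pr : p != r) :
    q != r -> (forall s, [\/ s = p, s = q | s = r]) ->
  star (inr p : vert G) (old (val p)) (new pq) (new pr).
Proof.
move=> qr cov; split=> //; first exact: base_old_at.
  rewrite /= !inE /= andbT; apply/eqP => -[E]; by rewrite E eqxx in qr.
move=> [e E|u].
  constructor 1; congr inl; have [ev|ev] := eqVneq (base e) v; last by rewrite (base_old_off ev) in E.
  have /eqP ev' := ev; have Es : e = val (Sub e ev' : darts_at v) by [].
  by move: E; rewrite Es base_old_at => -[<-].
move=> -[E]; have := valP u; rewrite E [val u]surjective_pairing E /= => pu.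
case: (cov (val u).2) => Eu; first by rewrite Eu eqxx in pu.
  by constructor 2; congr inr; apply: val_inj; rewrite /= [val u]surjective_pairing E Eu.
by constructor 3; congr inr; apply: val_inj; rewrite /= [val u]surjective_pairing E Eu.
Qed.

Lemma triangle_exists p q : p != q -> exists r pq qr rp,
  [/\ triangle p q r pq qr rp, star v (val p) (val q) (val r) &
     forall s, [\/ s = p, s = q | s = r]].
Proof.
move=> pq; have vp : base (val p) = v by apply/eqP/(valP p).
have vq : base (val q) = v by apply/eqP/(valP q).
have qp' : val q != val p by rewrite eq_sym (inj_eq val_inj).
have := star_third (etrans vq (esym vp)) qp'; rewrite vp.
set r' := third_dart _ _ => st; have [_ _ vr u cov] := st.
have vr' : base r' == v by apply/eqP.
pose r : darts_at v := Sub r' vr'.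
have cov' s : [\/ s = p, s = q | s = r].
  by case: (cov (val s) (eqP (valP s))) => E;
    [constructor 1 | constructor 2 | constructor 3]; apply: val_inj.
have [qr rp] : q != r /\ r != p.
  move: u; rewrite /= !inE negb_or andbT -!andbA => /and3P[_ n1 n2].
  by rewrite -!(inj_eq val_inj) n2 eq_sym n1.
have [qp rq pr] : [/\ q != p, r != q & p != r] by split; rewrite eq_sym.
have oN s t (st' : s != t) (ts : t != s) : opp (new st') = new ts.
  by congr inr; apply: val_inj.
exists r, (new pq), (new qr), (new rp); split=> //; split; split.
- by rewrite (oN _ _ _ pr); apply: new_star.
- rewrite (oN _ _ _ qp); apply: new_star => //.
  by move=> s; case: (cov' s); [constructor 3 | constructor 1 | constructor 2].
- rewrite (oN _ _ _ rq); apply: new_star => //.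
  by move=> s; case: (cov' s); [constructor 2 | constructor 3 | constructor 1].
- have ne (a b c d : darts_at v) (ab : a != b) (cd : c != d) :
      (a != c) && (a != d) || (b != c) && (b != d) ->
      edge_of (new ab) != edge_of (new cd).
    move=> h; apply: contraTneq h => /eqP/edge_ofP[].
      by case=> -> ->; rewrite !eqxx andbF.
    by case=> -> ->; rewrite !eqxx andbF.
  rewrite /= !inE negb_or andbT; do ![apply/andP; split]; apply: ne.
  + by rewrite pq pr.
  + by rewrite qr qp orbT.
  + by rewrite qr qp.
- move=> d; rewrite !inE !negb_or; do ![apply/andP; split];
    by apply/negP => /edge_ofP[].
move=> [d|t]; [by left; exists d | right].
have key a b (ab : a != b) : (val t).1 = a /\ (val t).2 = b \/
      (val t).1 = b /\ (val t).2 = a ->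
    edge_of (inr t : dart G) = edge_of (new ab).
  move=> st'; apply/eqP/edge_ofP; case: st' => -[E1 E2]; [left | right];
  by congr inr; apply: val_inj; rewrite /= [val t]surjective_pairing E1 E2.
have := valP t; rewrite !inE; case: (cov' (val t).1) => Es; case: (cov' (val t).2) => Et;
  rewrite ?Es ?Et ?eqxx // => _.
- by rewrite (key _ _ pq) ?eqxx //; auto.
- by rewrite (key _ _ rp) ?eqxx ?orbT //; auto.
- by rewrite (key _ _ pq) ?eqxx //; auto.
- by rewrite (key _ _ qr) ?eqxx ?orbT //; auto.
- by rewrite (key _ _ rp) ?eqxx ?orbT //; auto.
- by rewrite (key _ _ qr) ?eqxx ?orbT //; auto.
Qed.

Lemma edge_of_old_inj d e : edge_of (old d) = edge_of (old e) -> edge_of d = edge_of e.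
Proof. by move/eqP/edge_ofP => [[->]|[->]] //; rewrite edge_of_opp. Qed.

End Inflation.

(** * Counting uncovered edges around the triangle *)

Section Chase.
Variables (K : mgraph) (v : vert K).
Hypotheses (cubK : cubic K) (girthK : girth_at_least K 5).
Local Notation G := (inflate v).
Local Notation old d := (inl d : dart G).
Implicit Types (d e : dart K) (p q r : darts_at v).

Variables m1 m2 m3 : dart G -> bool.
Hypotheses (M1 : matching m1) (M2 : matching m2) (M3 : matching m3).

Let U := uncovered_by [:: m1; m2; m3].
Let dbl (x : dart G) := 1 < m1 x + m2 x + m3 x.

Let UE x : U x = ~~ [|| m1 x, m2 x | m3 x].
Proof. by rewrite /U /uncovered_by /= andbT !negb_or. Qed.

Let one3_at (x : vert G) (d d' d'' : dart G) : star x d d' d'' ->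
  [/\ one3 (m1 d) (m1 d') (m1 d''), one3 (m2 d) (m2 d') (m2 d'')
    & one3 (m3 d) (m3 d') (m3 d'')].
Proof.
move=> st; have [[_ h1] [[_ h2] [_ h3]]] := (M1, (M2, M3)).
by split; apply/(exactly_one_star _ st).
Qed.

(** The three matchings meet a vertex three times in all, so a doubly covered edge leaves at most
    one incidence for the other two edges. The next two facts rest on the same count. *)
Let dbl_uncovered d : base d != v -> dbl (old d) ->
  exists e, [/\ base e = base d, e <> d & U (old e)].
Proof.
move=> dv; have [d' [d'' st]] := star_at cubK d.
have [_ b' b''] := st; rewrite /= !inE negb_or andbT -andbA => /and3P[/eqP n1 /eqP n2 _] _.
have [h1 h2 h3] := one3_at (star_old dv st).
have [U'|U'] : U (old d') \/ U (old d'') \/ ~~ dbl (old d).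
- rewrite !UE /dbl; move: h1 h2 h3; rewrite /one3.
  case: (m1 _) (m1 _) (m1 _) => [] [] [] //;
  case: (m2 _) (m2 _) (m2 _) => [] [] [] //;
  case: (m3 _) (m3 _) (m3 _) => [] [] [] //; auto.
- by move=> _; exists d'; split=> // E; case: n1.
by case: U' => [U' _|/negPf->] //; exists d''; split=> // E; case: n2.
Qed.

Let triple_uncovered d : base d != v -> m1 (old d) -> m2 (old d) -> m3 (old d) ->
  exists e f, [/\ base e = base d, base f = base d, e <> f, U (old e) & U (old f)].
Proof.
move=> dv; have [d' [d'' st]] := star_at cubK d.
have [_ b' b''] := st; rewrite /= !inE negb_or andbT -andbA => /and3P[_ _ /eqP n] _.
have [h1 h2 h3] := one3_at (star_old dv st).
move=> e1 e2 e3; exists d', d''; rewrite !UE; split=> //.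
  by move: h1 h2 h3; rewrite /one3 e1 e2 e3; do 3!case: (_ (old d')).
by move: h1 h2 h3; rewrite /one3 e1 e2 e3; do 3!case: (_ (old d''));
  rewrite ?addn1 ?addn0 // !addnS.
Qed.

Let uncovered_dbl d : base d != v -> U (old d) ->
    (forall e, base e = base d -> U (old e) -> e = d) ->
  exists e, [/\ base e = base d, e <> d & dbl (old e)].
Proof.
move=> dv; have [d' [d'' st]] := star_at cubK d.
have [_ b' b''] := st; rewrite /= !inE negb_or andbT -andbA => /and3P[/eqP n1 /eqP n2 _] _.
have [h1 h2 h3] := one3_at (star_old dv st).
move=> Ud only; have U' : ~~ U (old d') by apply/negP => /only E; case: n1; rewrite E.
have U'' : ~~ U (old d'') by apply/negP => /only E; case: n2; rewrite E.
have [D|D] : dbl (old d') \/ dbl (old d'').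
- move: Ud U' U''; rewrite !UE /dbl !negbK; move: h1 h2 h3; rewrite /one3.
  case: (m1 _) (m1 _) (m1 _) => [] [] [] //;
  case: (m2 _) (m2 _) (m2 _) => [] [] [] //;
  case: (m3 _) (m3 _) (m3 _) => [] [] [] //; auto.
- by exists d'; split=> // E; case: n1.
by exists d''; split=> // E; case: n2.
Qed.

Hypothesis few : forall s : seq (dart G),
  uniq [seq edge_of x | x <- s] -> all U s -> size s <= 3.

Let off_v p : base (opp (val p)) != v.
Proof.
by apply/eqP => E; apply: (girth_loop girthK (d := val p)); rewrite E; apply/esym/eqP/(valP p).
Qed.

Let other p : exists q, p != q.
Proof.
have [d [d' [_ bd' _ u _]]] := star_at cubK (val p).
have bd : base d = v by rewrite bd' (eqP (valP p)).
exists (Sub d (introT eqP bd)); rewrite -val_eqE /=.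
by move: u; rewrite /= !inE negb_or => /andP[/andP[]].
Qed.

(** Otherwise the other two edges at each end of this outer edge would be uncovered, four in all. *)
Let not_triple p : ~~ [&& m1 (old (val p)), m2 (old (val p)) & m3 (old (val p))].
Proof.
apply/negP=> /and3P[t1 t2 t3].
have [q pq] := other p; have [r [x [y [z [tri st cov]]]]] := triangle_exists cubK pq.
have [e [f [be bf ef Ue Uf]]] : exists e f, [/\ base e = base (opp (val p)),
    base f = base (opp (val p)), e <> f, U (old e) & U (old f)].
  apply: triple_uncovered; rewrite ?off_v //.
  - by have [/(_ (old (val p)))] := M1; rewrite /= t1.
  - by have [/(_ (old (val p)))] := M2; rewrite /= t2.
  - by have [/(_ (old (val p)))] := M3; rewrite /= t3.
have [[sp sq sr] [utri otri _]] := tri.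
have Uxz : U x && U (opp z).
  have [] := one3_at sp; rewrite !UE /one3 t1 t2 t3.
  by case: (m1 x) (m1 (opp z)) (m2 x) (m2 (opp z)) (m3 x) (m3 (opp z)) => [] [] [] [] [] [].
have /andP[Ux Uz] := Uxz.
suff u4 : uniq [seq edge_of u | u <- [:: x; opp z; old e; old f]].
  by have := few u4; rewrite /= Ux Uz Ue Uf => /(_ isT).
move: utri (otri e) (otri f); rewrite [map _ _]/= !cons_uniq !inE !edge_of_opp !negb_or !andbT.
move=> /andP[/andP[_ xz] _] /and3P[ex _ ez] /and3P[fx _ fz].
rewrite xz eq_sym ex eq_sym fx eq_sym ez eq_sym fz /=.
apply/negP => /eqP/edge_of_old_inj/eqP/edge_ofP[] // E.
by apply: (girth_loop girthK (d := f)); rewrite -E be bf.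
Qed.

(** The triangle has an odd number of vertices, so a perfect matching must leave it. *)
Let matching_outer m : matching m -> exists p, m (old (val p)).
Proof.
case=> mo mP; have [d [/eqP dv _]] : exists d, base d = v /\ true.
  have := cubK v; rewrite /degree => c3.
  have /card_gt0P[d] : 0 < #|[set d | base d == v]| by rewrite c3.
  by rewrite inE => /eqP dv; exists d.
pose p : darts_at v := Sub d dv; have [q pq] := other p.
have [r [x [y [z [[[sp sq sr] _] _ _]]]]] := triangle_exists cubK pq.
have hp := proj1 (exactly_one_star m sp) (mP _).
have hq := proj1 (exactly_one_star m sq) (mP _).
have hr := proj1 (exactly_one_star m sr) (mP _).
move: hp hq hr; rewrite !mo /one3.
case Ep: (m (old (val p))); first by exists p.
case Eq: (m (old (val q))); first by exists q.
case Er: (m (old (val r))); first by exists r.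
by case: (m x) (m y) (m z) => [] [] [].
Qed.

Lemma heavy_vertex_array : (forall p, m1 (old (val p))) ->
  heavy_vertex v /\
  exists s : seq (dart G), [/\ uniq [seq edge_of x | x <- s], all U s & size s = 3].
Proof.
move=> m1v.
have [[o1 ex1] [[o2 ex2] [o3 ex3]]] := (M1, (M2, M3)).
have [p m2p] := matching_outer M2; have [q m3q] := matching_outer M3.
have pq : p != q.
  by apply/eqP => E; case/negP: (not_triple p); rewrite m1v m2p E m3q.
have [r [x [y [z [tri st cov]]]]] := triangle_exists cubK pq.
have [[sp sq sr] [utri otri _]] := tri.
have m3p : m3 (old (val p)) = false.
  by have := not_triple p; rewrite m1v m2p /= => /negPf.
have m2q : m2 (old (val q)) = false.
  by have := not_triple q; rewrite m1v m3q /= andbT => /negPf.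
(* Inside the triangle [m2] has to join [q] with [r], and [m3] has to join [p] with [r]. So the
   outer edge at [r] is only in [m1], and the edge [x] between [p] and [q] is uncovered. *)
have [Ux m2r m3r] : [/\ U x, ~~ m2 (old (val r)) & ~~ m3 (old (val r))].
  have [a1 a2 a3] := one3_at sp; have [b1 b2 b3] := one3_at sq; have [c1 c2 c3] := one3_at sr.
  move: a1 a2 a3 b1 b2 b3 c1 c2 c3; rewrite UE !o1 !o2 !o3 !m1v m2p m3q m3p m2q /one3.
  by case: (m1 x) (m1 y) (m1 z) => [] [] [] //; case: (m2 x) (m2 y) (m2 z) => [] [] [] //;
     case: (m3 x) (m3 y) (m3 z) => [] [] [] //; case: (m2 _) => //; case: (m3 _).
have bp : base (val p) = v by apply/eqP/(valP p).
have bq : base (val q) = v by apply/eqP/(valP q).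
have oo d : opp (old d) = old (opp d) by [].
(* The outer edges at [p] and [q] are doubly covered, and each forces an uncovered edge at its far
   end. *)
have [f [bf fp Uf]] : exists f, [/\ base f = base (opp (val p)), f <> opp (val p) & U (old f)].
  by apply: dbl_uncovered; rewrite ?off_v // /dbl -oo o1 o2 m1v m2p.
have [g [bg gq Ug]] : exists g, [/\ base g = base (opp (val q)), g <> opp (val q) & U (old g)].
  by apply: dbl_uncovered; rewrite ?off_v // /dbl -oo o1 o3 m1v m3q addnAC.
move/eqP: pq => pq; have pq' : val p <> val q by move=> E; apply: pq; apply: val_inj.
have loop := girth_loop girthK; have par := girth_parallel girthK.
have triK := girth_triangle girthK; have sqK := girth_square girthK.
have oK := @oppK K.
have ab : base (opp (val p)) <> base (opp (val q)).
  by move=> E; apply/pq'/par; rewrite // bp bq.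
have fb : base (opp f) <> base (opp (val q)).
  by move=> E; apply: (triK (val p) f (opp (val q))); rewrite ?oK //; congruence.
have ga : base (opp g) <> base (opp (val p)).
  by move=> E; apply: (triK (val q) g (opp (val p))); rewrite ?oK //; congruence.
have fv : base (opp f) <> v.
  move=> E; apply: fp; rewrite -(oK f); congr opp; apply: par; first congruence.
  by rewrite oK.
have gv : base (opp g) <> v.
  move=> E; apply: gq; rewrite -(oK g); congr opp; apply: par; first congruence.
  by rewrite oK.
have fg : base (opp f) <> base (opp g).
  move=> E; apply: (sqK (val p) f (opp g) (opp (val q))); rewrite ?oK //; try congruence.
have efg : edge_of f != edge_of g.
  by apply/negP => /edge_ofP[] E; [apply: ab; congruence | apply: fb; congruence].
have u3 : uniq [seq edge_of u | u <- [:: x; old f; old g]].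
  rewrite /= !inE negb_or andbT; have := otri f; have := otri g; rewrite !inE !negb_or.
  move=> /andP[gx _] /andP[fx _]; rewrite eq_sym fx eq_sym gx /=.
  by apply: contraNneq efg => /edge_of_old_inj->.
(* By [few] there is no fourth uncovered edge besides [x], [f] and [g]. *)
have only d : U (old d) -> [\/ d = f, d = opp f, d = g | d = opp g].
  move=> Ud.
  have [dfg|ndfg] := boolP (edge_of d \in [:: edge_of f; edge_of g]).
    move: dfg; rewrite !inE => /orP[] /edge_ofP[] E;
    [constructor 1 | constructor 2 | constructor 3 | constructor 4]; exact: E.
  suff dN : edge_of (old d) \notin [seq edge_of u | u <- [:: x; old f; old g]].
    have := few (s := [:: old d, x & [:: old f; old g]]).
    by rewrite map_cons cons_uniq dN u3 /= Ud Ux Uf Ug => /(_ isT isT).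
  have := otri d; rewrite !inE !negb_or => /andP[-> _] /=.
  move: ndfg; rewrite !inE negb_or => /andP[nf ng].
  by apply/andP; split; [apply: contraNneq nf | apply: contraNneq ng] => /edge_of_old_inj->.
have fv' : base (opp f) != v by apply/eqP.
(* At the far end of [f] no other edge is uncovered, so some [h] there is doubly covered, and the
   far end of [h] again carries an uncovered edge. *)
have [h [bh hf Dh]] : exists h, [/\ base h = base (opp f), h <> opp f & dbl (old h)].
  apply: uncovered_dbl => //; first by rewrite UE -oo o1 o2 o3 -UE.
  by move=> d bd /only[] // E; exfalso; congruence.
have Doh : dbl (old (opp h)) by rewrite /dbl -oo o1 o2 o3.
have hv : base (opp h) != v.
  (* If [h] ended at [v] it would be an outer edge: those at [p] and [q] give a loop or a triangle,
     and the one at [r] is not doubly covered. *)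
  apply/eqP => E; have [_ _ _ _ covv] := st; case: (covv _ E) => E'.
  - by apply: (loop f); rewrite -bh bf -E' oK.
  - by apply: fb; rewrite -bh -E' oK.
  by move: Doh; rewrite E' /dbl (negPf m2r) (negPf m3r); case: (m1 _).
have [k [bk kh /only kfg]] := dbl_uncovered hv Doh.
(* Taking [f], [opp f] or [g] for [k] yields parallel edges, a loop or a circuit of length four; so
   [k] is [opp g] and the path closes up. *)
have bh' : base (opp h) = base (opp g).
  case: kfg => E; last (by rewrite -bk E); exfalso.
  - by apply: hf; apply: par; rewrite ?oK //; congruence.
  - by apply: (loop h); congruence.
  - apply: (sqK (val p) f h (opp (val q))); rewrite ?oK //; try congruence.
have five_v : five (val p) f h (opp g) (opp (val q)).
  have vp := off_v p; have vq := off_v q.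
  have fa : base (opp f) != base (opp (val p)) by rewrite -bf; apply/eqP/loop.
  have gb : base (opp g) != base (opp (val q)) by rewrite -bg; apply/eqP/loop.
  apply/fiveP; rewrite !oK bh' bh bf bg bp bq; split; first by split.
  rewrite /= !inE !negb_or !andbT; move: fv gv fg fb ga ab.
  move=> /eqP fv /eqP gv /eqP fg /eqP fb /eqP ga /eqP ab.
  rewrite gb fb fg ab ![v == _]eq_sym vp vq fv gv /=.
  by rewrite eq_sym fa eq_sym ga.
(* The colour tells which matching covers the edge, [Some false] standing for [m3]. At a vertex off
   the circuit all three edges are covered, hence each exactly once. *)
pose c d := if m1 (old d) then None else Some (m2 (old d)).
split; last by exists [:: x; old f; old g]; split; rewrite //= Ux Uf Ug.
exists (val p), f, h, (opp g), (opp (val q)), c; split=> //; split=> [d|w wS d e dw ew].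
  by rewrite /c -oo o1 o2.
have wv : base d != v by rewrite dw; apply: contraNneq wS => ->; rewrite inE /= bp inE eqxx.
have cover a : base a = w -> m1 (old a) || m2 (old a) || m3 (old a).
  move=> aw; apply: contraT; rewrite -orbA -UE => /only aE; case/negP: wS; rewrite -aw.
  by rewrite !inE; case: aE => ->; rewrite ?bf ?bg ?bh ?eqxx ?orbT.
have bde : base (old e) = base (old d) by apply/(base_old_eq _ wv); rewrite ew dw.
have inj_m m : exactly_one m (base (old d)) -> m (old d) -> m (old e) -> d = e.
  case=> t [_ _ tU] md me.
  by have [->] : old d = old e by rewrite (tU _ (erefl _) md) (tU _ bde me).
have := cover d dw; have := cover e ew; rewrite /c.
case E1: (m1 (old d)); case E2: (m1 (old e)) => //=; first by move=> *; apply: inj_m (ex1 _) _ _.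
move=> ce cd [E]; rewrite E in cd; case E3: (m2 (old e)) in E ce cd.
  by apply: inj_m (ex2 _) _ _.
by apply: inj_m (ex3 _) _ _.
Qed.

End Chase.

(** Lets a chosen matching of an array be listed first. *)
Lemma ord3_cover (i : 'I_3) : exists j k : 'I_3, forall l, [\/ l = i, l = j | l = k].
Proof.
have cov (j k : 'I_3) : (forall l : 'I_3, [|| l == i :> nat, l == j :> nat | l == k :> nat]) ->
    exists j k : 'I_3, forall l, [\/ l = i, l = j | l = k].
  move=> c; exists j, k => l; case/or3P: (c l) => /eqP E;
  [constructor 1 | constructor 2 | constructor 3]; exact: val_inj.
pose o n h := @Ordinal 3 n h.
case: i cov => [[|[|[|]]] //= i3] cov.
- by apply: (cov (o 1 isT) (o 2 isT)) => -[[|[|[|]]]].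
- by apply: (cov (o 0 isT) (o 2 isT)) => -[[|[|[|]]]].
- by apply: (cov (o 0 isT) (o 1 isT)) => -[[|[|[|]]]].
Qed.

(** * Passing between 3-arrays of the inflation and matchings of the original graph *)

Section Contraction.
Variables (K : mgraph) (v : vert K).
Hypotheses (cubK : cubic K) (girthK : girth_at_least K 5).
Local Notation G := (inflate v).
Local Notation old d := (inl d : dart G).
Implicit Types (d e : dart K) (p q r : darts_at v) (m : dart G -> bool).

Lemma darts_at_pair : exists p q, p != q.
Proof.
have /eqP := cubK v; rewrite /degree => c3.
have /card_gt0P[d] : 0 < #|[set d | base d == v]| by rewrite (eqP c3).
rewrite inE => dv; have [e [e' [_ ev _ u _]]] := star_at cubK d.
have ev' : base e == v by rewrite ev.
exists (Sub d dv), (Sub e ev'); rewrite -val_eqE /=.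
by move: u; rewrite /= !inE negb_or => /andP[/andP[]].
Qed.

(** By parity a perfect matching contains an odd number of the edges leaving the triangle. If one of
    them is missing, exactly one is present and the matching survives the contraction. *)
Lemma matching_contract m p : matching m -> ~~ m (old (val p)) ->
  matching (fun d => m (old d)).
Proof.
move=> [mo mP] mp; split=> [d|x]; first exact: mo (old d).
have [->|xv] := eqVneq x v; last first.
  have /card_gt0P[d0] : 0 < #|[set d | base d == x]|.
    by have := cubK x; rewrite /degree => ->.
  rewrite inE => /eqP bd0; rewrite -bd0 in xv *.
  have [d' [d'' st]] := star_at cubK d0.
  apply/(exactly_one_star _ st); apply/(exactly_one_star _ (star_old xv st)); exact: mP.
have [q pq] : exists q, p != q.
  have [a [b ab]] := darts_at_pair; have [E|] := eqVneq p a; last by exists a.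
  by exists b; rewrite E.
have [r [x' [y [z [[[sp sq sr] _] st _]]]]] := triangle_exists cubK pq.
have hp := proj1 (exactly_one_star m sp) (mP _).
have hq := proj1 (exactly_one_star m sq) (mP _).
have hr := proj1 (exactly_one_star m sr) (mP _).
apply/(exactly_one_star _ st); move: hp hq hr; rewrite !mo (negPf mp) /one3.
by case: (m (old (val q))) (m (old (val r))) (m x') (m y) (m z) => [] [] [] [] [].
Qed.

Lemma edge_of_old d : edge_of (old d) = [set old e | e in edge_of d].
Proof. by rewrite /edge_of imsetU1 imset_set1. Qed.

Lemma defect_contract (A : array3 G) : is_array3 A ->
    (forall i, exists p, edge_of (old (val p)) \notin A i) ->
  defect K <= #|uncovered A|.
Proof.
move=> /forallP AP out; pose m (i : 'I_3) d := edge_of (old d) \in A i.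
have mP i : matching (m i).
  have [p np] := out i; apply: (@matching_contract (fun x => edge_of x \in A i) p) => //.
  exact: perfect_matching_matching.
have [i1 [i2 cov]] := ord3_cover ord0; set i0 : 'I_3 := ord0 in cov.
apply: leq_trans (defect_le_matchings (mP i0) (mP i1) (mP i2)) _.
have f_inj : injective (fun E : {set dart K} => [set old e | e in E]).
  by apply: imset_inj => d e [].
rewrite -(card_imset _ f_inj); apply/subset_leq_card/subsetP => _ /imsetP[_ /imsetP[d dU ->] ->].
rewrite -edge_of_old; apply/uncoveredP => i.
move: dU; rewrite inE /uncovered_by /= andbT => /and3P[n0 n1 n2].
by case: (cov i) => ->.
Qed.

(** If every matching missed some edge leaving the triangle, contraction would contradict
    [4 <= defect K]. The second conclusion serves as the lower bound on the defect of the
    inflation. *)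
Lemma array_inflate (A : array3 G) : 4 <= defect K -> is_array3 A -> #|uncovered A| <= 3 ->
  heavy_vertex v /\ 3 <= #|uncovered A|.
Proof.
move=> dK AP A3.
have [i out] : exists i, forall p, edge_of (old (val p)) \in A i.
  have [/existsP[i /forallP]|] :=
    boolP [exists i, [forall p : darts_at v, edge_of (old (val p)) \in A i]].
    by exists i.
  rewrite negb_exists => /forallP no; suff : defect K <= #|uncovered A| by lia.
  by apply: defect_contract => // i; have := no i; rewrite negb_forall => /existsP.
have [j [k cov]] := ord3_cover i; pose m (l : 'I_3) x := edge_of x \in A l.
have mP l : matching (m l) by apply: perfect_matching_matching; apply: (forallP AP).
have UE : uncovered_by [:: m i; m j; m k] =1 (fun x => edge_of x \in uncovered A).
  move=> x; apply/idP/uncoveredP => [/and4P[ni nj nk _] l|U]; first by case: (cov l) => ->.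
  by apply/and4P; split; rewrite // U.
have few s : uniq [seq edge_of x | x <- s] -> all (uncovered_by [:: m i; m j; m k]) s -> size s <= 3.
  by move=> us; rewrite (eq_all UE) => /(size_le_uncovered us)/leq_trans->.
have [hv [s [us Us <-]]] := heavy_vertex_array cubK girthK (mP i) (mP j) (mP k) few out.
by split=> //; apply: size_le_uncovered => //; rewrite -(eq_all UE).
Qed.

(** At [v] itself [m'] may fail to be a matching: one of the three matchings needed contains all the
    edges leaving the triangle. *)
Lemma matching_extend p q r (x y z : dart G) (m' : dart K -> bool) bx bY bz :
    triangle p q r x y z -> (forall s, [\/ s = p, s = q | s = r]) -> opp_invariant m' ->
    (forall w, w != v -> exactly_one m' w) ->
    one3 (m' (val p)) bx bz -> one3 (m' (val q)) bY bx -> one3 (m' (val r)) bz bY ->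
  exists m, [/\ matching m, forall d, m (old d) = m' d & [/\ m x = bx, m y = bY & m z = bz]].
Proof.
move=> [[sp sq sr] [uT oT _]] cov mo mP hp hq hr.
pose T := [:: edge_of x; edge_of y; edge_of z].
pose m (u : dart G) :=
  nth (if u is inl d then m' d else false) [:: bx; bY; bz] (index (edge_of u) T).
have mE d : m (old d) = m' d.
  by rewrite /m nth_default // leqNgt -[size _]/(size T) index_mem; apply: oT.
have mT i : i < 3 -> index (nth (edge_of x) T i) T = i by move=> i3; rewrite index_uniq.
have [mx my mz] : [/\ m x = bx, m y = bY & m z = bz].
  by rewrite /m (mT 0) // (mT 1) // (mT 2).
have mopp : opp_invariant m.
  move=> u; rewrite /m edge_of_opp; case: u => [d|t] //=.
  by rewrite mo.
exists m; split=> //; split=> // -[[w wv]|s].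
  have [d [bd _ _]] := mP w wv; have dv : base d != v by rewrite bd.
  have [d' [d'' st]] := star_at cubK d.
  have -> : inl (exist _ w wv) = base (old d) :> vert G.
    by rewrite (base_old_off dv); congr inl; apply: val_inj; rewrite /= bd.
  apply/(exactly_one_star _ (star_old dv st)); rewrite !mE.
  by apply/(exactly_one_star _ st); rewrite bd; apply: mP.
case: (cov s) => ->.
- by apply/(exactly_one_star _ sp); rewrite mopp mE mx mz.
- by apply/(exactly_one_star _ sq); rewrite mopp mE my mx.
- by apply/(exactly_one_star _ sr); rewrite mopp mE mz my.
Qed.

Lemma five_star d1 d2 d3 d4 d5 : five d1 d2 d3 d4 d5 ->
  star (base d1) d1 (opp d5) (outer d5 d1).
Proof.
case/fiveP=> -[b1 _ _ _ b5] /uniq5P[[_ _ _ _] [_ _ n25] _ _ _].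
apply: star_third => //; apply/eqP => E; apply: n25.
by rewrite -b1 -E oppK.
Qed.

(** The class of colour [k] is completed along the circuit by the bits [b1] to [b5]. The vertex
    [base d1] is exempt, since it is to be replaced by the triangle. *)
Lemma colour_class_matching d1 d2 d3 d4 d5 c k b1 b2 b3 b4 b5 :
    five d1 d2 d3 d4 d5 -> off_five d1 d2 d3 d4 d5 c ->
    one3 b2 b1 (c (outer d1 d2) == k) -> one3 b3 b2 (c (outer d2 d3) == k) ->
    one3 b4 b3 (c (outer d3 d4) == k) -> one3 b5 b4 (c (outer d4 d5) == k) ->
  exists m' : dart K -> bool, [/\ opp_invariant m', forall w, w != base d1 -> exactly_one m' w,
    [/\ m' d1 = b1, m' d2 = b2, m' d3 = b3, m' d4 = b4 & m' d5 = b5]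
    & {in off_edges [:: d1; d2; d3; d4; d5], forall d, m' d = (c d == k)}].
Proof.
move=> f1 cC h2 h3 h4 h5; have f2 := five_rot f1; have f3 := five_rot f2.
have f4 := five_rot f3; have f5 := five_rot f4.
have co : opp_invariant (fun d => c d == k) by move=> d /=; rewrite (proj1 cC).
have [m' [mo [E1 E2 E3 E4 E5] mE]] := recolour_five b1 b2 b3 b4 b5 f1 co.
exists m'; split=> // w w1.
have [uos os] := outers_boundary cubK f1.
have oE o : o \in [:: outer d5 d1; outer d1 d2; outer d2 d3; outer d3 d4; outer d4 d5] ->
    m' o = (c o == k) by rewrite os => /andP[/mE].
have [wC|wC] := boolP (w \in [seq base e | e <- [:: d1; d2; d3; d4; d5]]).
  move: wC; rewrite !inE (negPf w1) /= => /or4P[] /eqP->.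
  - by apply/(exactly_one_star _ (five_star f2)); rewrite mo E1 E2 oE // !inE eqxx ?orbT.
  - by apply/(exactly_one_star _ (five_star f3)); rewrite mo E2 E3 oE // !inE eqxx ?orbT.
  - by apply/(exactly_one_star _ (five_star f4)); rewrite mo E3 E4 oE // !inE eqxx ?orbT.
  - by apply/(exactly_one_star _ (five_star f5)); rewrite mo E4 E5 oE // !inE eqxx ?orbT.
have off d : base d = w -> m' d = (c d == k).
  by move=> bd; apply: mE; apply: (five_off_edges f1); rewrite bd.
have [d bd dk] := proper_surj cubK cC k wC.
exists d; rewrite off // dk; split=> // e be; rewrite off // => /eqP ek.
by apply: (proj2 cC _ wC); rewrite ?ek.
Qed.

(** The colouring is centred at [v]. Each matching is a colour class off the circuit, completed
    around the triangle and along the circuit. *)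
Lemma defect_inflate_le : ~ colourable K -> heavy_vertex v -> defect G <= 3.
Proof.
move=> ncolK [d1 [d2 [d3 [d4 [d5 [c0 [f bv c0C]]]]]]].
have [[c [cC cent]] _ _ _ _] := heavy_everywhere cubK ncolK f c0C.
have := cent; rewrite /centred => /and3P[/eqP w3 /eqP w4].
rewrite /= !inE negb_or andbT => /andP[/andP[n12 n15] n25].
have [_ b5 _ u5 cov5] := five_star f; rewrite bv in b5 cov5.
pose p : darts_at v := Sub d1 (introT eqP bv).
pose q : darts_at v := Sub (opp d5) (introT eqP b5).
have pq : p != q.
  by rewrite -val_eqE /=; move: u5; rewrite /= !inE negb_or => /andP[/andP[]].
have [r [x [y [z [tri st cov]]]]] := triangle_exists cubK pq.
have Er : val r = outer d5 d1.
  have [_ _ br ur _] := st; case: (cov5 _ br) => // E; move: ur;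
  by rewrite /= E !inE eqxx ?orbT ?andbF.
have ext k b1 b2 b3 b4 b5' bx bY bz :
    one3 b2 b1 (c (outer d1 d2) == k) -> one3 b3 b2 (c (outer d2 d3) == k) ->
    one3 b4 b3 (c (outer d3 d4) == k) -> one3 b5' b4 (c (outer d4 d5) == k) ->
    one3 b1 bx bz -> one3 b5' bY bx -> one3 (c (outer d5 d1) == k) bz bY ->
    exists m, [/\ matching m, [/\ m x = bx, m y = bY & m z = bz],
      [/\ m (old d1) = b1, m (old d3) = b3 & m (old d5) = b5']
      & {in off_edges [:: d1; d2; d3; d4; d5], forall d, m (old d) = (c d == k)}].
  move=> h2 h3 h4 h5 hp hq hr.
  have [m' [mo mP [E1 E2 E3 E4 E5] mE]] := colour_class_matching f cC h2 h3 h4 h5.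
  have o1 : outer d5 d1 \in off_edges [:: d1; d2; d3; d4; d5] by have [] := outerP cubK f.
  have [||||m [mM mold mxyz]] := matching_extend (bx := bx) (bY := bY) (bz := bz) tri cov mo.
  - by move=> w wv; apply: mP; rewrite bv.
  - by rewrite /= E1.
  - by rewrite /= mo E5.
  - by rewrite Er mE.
  exists m; split=> //; first by rewrite !mold.
  by move=> d dC; rewrite mold mE.
have [n21 n51 n52] : [/\ c (outer d1 d2) != c (outer d5 d1),
    c (outer d4 d5) != c (outer d5 d1) & c (outer d4 d5) != c (outer d1 d2)].
  by split; rewrite eq_sym.
have ne := (negPf n12, negPf n15, negPf n25, negPf n21, negPf n51, negPf n52).
(* For outer colours a, b, a, a, c the classes of a, b and c are completed by [d1], [d5], by [d3],
   [d5], [z] and by [d1], [d3], [y] respectively. Only [x], [d2] and [d4] stay uncovered. *)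
have [|||||||m1 [M1 [x1 y1 z1] [a1 a3 a5] c1]] :=
  ext (c (outer d5 d1)) true false false false true false false false;
  rewrite ?w3 ?w4 ?eqxx ?ne //.
have [|||||||m2 [M2 [x2 y2 z2] [e1 e3 e5] c2]] :=
  ext (c (outer d1 d2)) false false true false true false false true;
  rewrite ?w3 ?w4 ?eqxx ?ne //.
have [|||||||m3 [M3 [x3 y3 z3] [g1 g3 g5] c3]] :=
  ext (c (outer d4 d5)) true false true false false false true false;
  rewrite ?w3 ?w4 ?eqxx ?ne //.
apply: leq_trans (defect_le_matchings M1 M2 M3) _.
pose s := [:: edge_of x; edge_of (old d2); edge_of (old d4)].
apply: leq_trans (card_size s); apply/subset_leq_card/subsetP => _ /imsetP[u uU ->].
rewrite inE /uncovered_by /= andbT in uU; case/and3P: uU => u1 u2 u3.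
have same m u' : matching m -> edge_of u = edge_of u' -> m u = m u'.
  by case=> mo _ /eqP/edge_ofP[] ->; rewrite ?mo.
have [_ [_ _ /(_ u)[[d Ed]|]]] := tri; last first.
  rewrite !inE => /or3P[] /eqP E; first by rewrite E eqxx.
    by move: u3; rewrite (same _ _ M3 E) y3.
  by move: u2; rewrite (same _ _ M2 E) z2.
have [dC|dC] := boolP (d \in off_edges [:: d1; d2; d3; d4; d5]).
  exfalso; move: u1 u2 u3; rewrite Ed c1 // c2 // c3 //; move: n12 n15 n25.
  by case: (c d) (c _) (c _) (c _) => [[]|] [[]|] [[]|] [[]|].
have oldE e : edge_of d = edge_of e -> edge_of u = edge_of (old e).
  by rewrite Ed !edge_of_old => ->.
move: dC; rewrite inE negbK /= !inE => /or4P[||| /orP[]] /eqP/oldE E.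
- by move: u1; rewrite (same _ _ M1 E) a1.
- by rewrite E eqxx orbT.
- by move: u2; rewrite (same _ _ M2 E) e3.
- by rewrite E eqxx !orbT.
- by move: u1; rewrite (same _ _ M1 E) a5.
Qed.

(** Keeps the default value in the definition of the defect above 3. *)
Lemma edges_inflate_gt : 3 < #|edges G|.
Proof.
have [p [q pq]] := darts_at_pair.
have [r [x [y [z [[_ [uT oT _]] _ _]]]]] := triangle_exists cubK pq.
have u4 : uniq [:: edge_of (old (val p)); edge_of x; edge_of y; edge_of z].
  by rewrite cons_uniq uT oT.
rewrite -[4]/(size [:: edge_of (old (val p)); edge_of x; edge_of y; edge_of z]).
rewrite -(card_uniqP u4); apply/subset_leq_card/subsetP => E.
by rewrite !inE => /or4P[] /eqP->; apply: imset_f.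
Qed.
End Contraction.

Theorem theorem5p2 (K : mgraph) (v : vert K) :
  nontrivial_snark K -> 4 <= defect K ->
  (defect (inflate v) = 3 <->
   exists2 H : {set {set dart K}}, heavy_cluster H & v \in vertices_of H).
Proof.
move=> [[cubK _ ncolK] _ girthK] dK.
rewrite -heavy_clusterP //; split=> [d3|hv].
  have [|A AP A3] := @defect_attained (inflate v); first by rewrite d3 edges_inflate_gt.
  by have [] := array_inflate cubK girthK dK AP _; rewrite ?A3 ?d3.
apply/eqP; rewrite eqn_leq defect_inflate_le //=.
apply: defect_ge => [|A AP]; first exact/ltnW/edges_inflate_gt.
have [A3|/ltnW //] := leqP #|uncovered A| 3.
by have [] := array_inflate cubK girthK dK AP A3.
Qed.
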